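(* The ReLU training problem for a network consisting of a single ReLU is NP-hard. That is, the following problem is NP-hard: given rational vectors $\mathbf{x}_1,\ldots,\mathbf{x}_m\in\mathbb{R}^n$, rational labels $y_1,\ldots,y_m\in\mathbb{R}$, a coefficient $\alpha_1\in\{+1,-1\}$ and a rational threshold $t\ge 0$, decide whether there exist $\mathbf{w}\in\mathbb{R}^n$ and $b\in\mathbb{R}$ such that $$\sum_{i=1}^m\big(\alpha_1[\langle \mathbf{w},\mathbf{x}_i\rangle+b]_+-y_i\big)^2\le t.$$
   Context: $[z]_+:=\max(0,z)$. A single ReLU computes $\mathbf{z}\mapsto\alpha_1[\langle\mathbf{w},\mathbf{z}\rangle+b]_+$, where $\mathbf{w}\in\mathbb{R}^n$ is the weight vector and $b\in\mathbb{R}$ the bias; the coefficient $\alpha_1$ is fixed as part of the input. The ReLU training problem asks to minimize the squared training error $\sum_{i}(f(\mathbf{x}_i)-y_i)^2$ over the weights and bias; NP-hardness refers to the decision version stated. *)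

(* Defs.v *)
From HB Require Import structures.
From mathcomp Require Import all_boot all_order all_algebra.
From mathcomp Require Import Rstruct.
From Stdlib Require Rdefinitions.
Notation R := Rdefinitions.R.
Import Order.TTheory GRing.Theory Num.Theory.

(* A computational model: deterministic single-tape Turing machines over the *)
(* tape alphabet {blank, 0, 1} (blank = None), two-way infinite tape.        *)

Inductive move := MoveL | MoveR | Stay.

Definition sym := option bool.

Record TM := {
  tm_state : finType;
  tm_start : tm_state;
  tm_halt : tm_state -> bool;
  tm_accept : tm_state -> bool;
  tm_delta : tm_state -> sym -> tm_state * sym * move
}.

Set Implicit Arguments.
Unset Strict Implicit.
Unset Printing Implicit Defensive.

(* configuration: state, left part of the tape (nearest cell first),
   scanned symbol, right part of the tape (nearest cell first) *)
Definition config (M : TM) := (tm_state M * seq sym * sym * seq sym)%type.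

Definition init (M : TM) (x : seq bool) : config M :=
  match x with
  | [::] => (tm_start M, [::], None, [::])
  | b :: x' => (tm_start M, [::], Some b, map Some x')
  end.

Definition step (M : TM) (c : config M) : config M :=
  let: (q, l, a, r) := c in
  if tm_halt M q then c else
  let: (q', w, mv) := tm_delta M q a in
  match mv with
  | Stay => (q', l, w, r)
  | MoveL => match l with
             | [::] => (q', [::], None, w :: r)
             | a' :: l' => (q', l', a', w :: r)
             end
  | MoveR => match r with
             | [::] => (q', w :: l, None, [::])
             | a' :: r' => (q', w :: l, a', r')
             end
  end.

Definition run (M : TM) (t : nat) (x : seq bool) : config M :=
  iter t (@step M) (init M x).

Definition cstate (M : TM) (c : config M) : tm_state M :=
  let: (q, _, _, _) := c in q.

Definition halts_within (M : TM) (t : nat) (x : seq bool) : bool :=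
  tm_halt M (cstate (run M t x)).

Definition accepts_at (M : TM) (t : nat) (x : seq bool) : bool :=
  tm_accept M (cstate (run M t x)).

Fixpoint read_bits (s : seq sym) : seq bool :=
  match s with
  | Some b :: s' => b :: read_bits s'
  | _ => [::]
  end.

Definition output (M : TM) (t : nat) (x : seq bool) : seq bool :=
  let: (_, _, a, r) := run M t x in read_bits (a :: r).

Definition pbound (c k n : nat) : nat := c * n ^ k + c.

Definition language := seq bool -> Prop.

Definition sdelim (s : seq bool) : seq bool :=
  flatten [seq [:: b; b] | b <- s] ++ [:: false; true].

Definition pair_enc (x u : seq bool) : seq bool := sdelim x ++ u.

Definition in_NP (L : language) : Prop :=
  exists (V : TM) (c k : nat),
    (forall x u, halts_within V (pbound c k (size x + size u)) (pair_enc x u)) /\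
    (forall x, L x <-> exists u, size u <= pbound c k (size x) /\
                 accepts_at V (pbound c k (size x + size u)) (pair_enc x u)).

Definition karp_reduces (L1 L2 : language) : Prop :=
  exists (F : TM) (c k : nat), forall x,
    halts_within F (pbound c k (size x)) x /\
    (L1 x <-> L2 (output F (pbound c k (size x)) x)).

Definition NP_hard (L : language) : Prop :=
  forall L', in_NP L' -> karp_reduces L' L.

Fixpoint nat_bits_aux (fuel n : nat) : seq bool :=
  match fuel with
  | 0 => [::]
  | f.+1 => if n == 0 then [::] else odd n :: nat_bits_aux f n./2
  end.

(* little-endian binary representation, no leading zeros *)
Definition nat_bits (n : nat) : seq bool := nat_bits_aux n n.

Definition enc_nat (n : nat) : seq bool := sdelim (nat_bits n).

Definition enc_int (z : int) : seq bool := (z < 0)%R :: enc_nat `|z|%N.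

Definition enc_rat (q : rat) : seq bool := enc_int (numq q) ++ enc_nat `|denq q|%N.

Definition enc_instance (m n : nat) (X : 'M[rat]_(m, n)) (y : 'cV[rat]_m)
    (a : bool) (t : rat) : seq bool :=
  enc_nat m ++ enc_nat n
  ++ flatten [seq enc_rat (X i j) | i <- enum 'I_m, j <- enum 'I_n]
  ++ flatten [seq enc_rat (y i ord0) | i <- enum 'I_m]
  ++ [:: a] ++ enc_rat t.

Local Open Scope ring_scope.

Definition relu (z : R) : R := Num.max 0 z.

Definition sgn_coef (a : bool) : R := if a then 1 else -1.

Definition relu_error (m n : nat) (X : 'M[rat]_(m, n)) (y : 'cV[rat]_m)
    (a : bool) (w : 'cV[R]_n) (b : R) : R :=
  \sum_(i < m)
     (sgn_coef a * relu (\sum_(j < n) ratr (X i j) * w j ord0 + b)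
        - ratr (y i ord0)) ^+ 2.

Definition relu_yes (m n : nat) (X : 'M[rat]_(m, n)) (y : 'cV[rat]_m)
    (a : bool) (t : rat) : Prop :=
  exists (w : 'cV[R]_n) (b : R), relu_error X y a w b <= ratr t.

Definition RELU_TRAIN : language := fun s =>
  exists (m n : nat) (X : 'M[rat]_(m, n)) (y : 'cV[rat]_m) (a : bool) (t : rat),
    [/\ 0 <= t, s = enc_instance X y a t & relu_yes X y a t].

(* Main.v *)
(** Cook-Levin tableau, compiled directly into training data.

    The run of a verifier within a polynomial time bound is a space-time tableau of
    cells, each of which is a function of three neighbouring cells one step earlier.
    "Some certificate is accepted" becomes the satisfiability of Horn clauses over the
    Boolean variables "cell J has content g" plus, for each certificate cell, one
    positive clause: the clauses propagate the contents of the true run, so that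
    uniqueness of the content of a cell need not be expressed.

    A Boolean variable v is forced by the three samples (e_v, 1), (-e_v, 1), (0, -1):
    their error is at least 2, with equality only if b <= 0 and w_v = 1 - b or
    w_v = -(1 - b).  With N variables and threshold t = 2N all other samples must be fitted
    exactly, and a sample (a, 0) with integer a then says that a.s <= 0 for the sign
    vector s of w: if a.s >= 1 the input of the ReLU is at least (1 - b) + b = 1.

    The reduction is computed by register programs on stacks of bits, which are
    compiled to a single tape by interleaving the stacks; the functions computed by
    such programs in polynomial time are closed under concatenation, case distinction
    and bounded loops, and the training instance is written down with these. *)
Require Import Defs.
From mathcomp Require Import all_boot all_order all_algebra.
From mathcomp Require Import Rstruct.
From mathcomp Require Import zify lra.
From Stdlib Require Import FunctionalExtensionality.
Import Order.TTheory GRing.Theory Num.Theory.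

Set Implicit Arguments.
Unset Strict Implicit.
Unset Printing Implicit Defensive.

(** The weights are known only up to the common factor [1 - b], which training is free to choose, so
    each clause has to be a homogeneous integer inequality in the signs. The bias cannot supply its
    constant term; a further Boolean variable, forced to be true, does. Integrality then separates
    violated constraints from satisfied ones whatever the scale.

    The certificate has unknown length and the verifier's clock depends on that length.

    On the machine side, whatever depends on the verifier alone (symbols, states, triples of cell
    contents) has constant size and is unrolled into the program; only cell numbers are looped over.
    These numbers and the number of variables are polynomially bounded, so programs hold them in
    unary and binary appears only when the instance is written out. *)

Definition tape := int -> sym.

Definition tupd (t : tape) (h : int) (w : sym) : tape :=
  fun z => if z == h then w else t z.

Lemma tupd_id t h : tupd t h (t h) = t.
Proof. by apply: functional_extensionality => z; rewrite /tupd; case: eqP => [->|]. Qed.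

Definition shift (mv : move) : int :=
  match mv with MoveL => (-1)%R | MoveR => 1%R | Stay => 0%R end.

(** * Turing machines with absolute head positions *)

(** Halting becomes a stationary transition that rewrites the scanned symbol. All steps then have
    the same shape, and the local rule of the tableau copies a final configuration from row to
    row. *)
Definition eff_delta (M : TM) (q : tm_state M) (s : sym) :=
  if tm_halt M q then (q, s, Stay) else tm_delta M q s.

Definition aconf (M : TM) := (tm_state M * int * tape)%type.

Definition astep (M : TM) (c : aconf M) : aconf M :=
  let: (q, h, t) := c in
  let: (q', w, mv) := eff_delta q (t h) in (q', (h + shift mv)%R, tupd t h w).

Definition tape_of_word (x : seq bool) : tape :=
  fun z => match z with Posz k => onth x k | Negz _ => None end.

Definition arun (M : TM) (n : nat) (x : seq bool) : aconf M :=
  iter n (@astep M) (tm_start M, 0%R, tape_of_word x).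

Definition view (l : seq sym) (a : sym) (r : seq sym) : tape :=
  fun z => match z with
           | Posz 0 => a
           | Posz k.+1 => nth None r k
           | Negz k => nth None l k
           end.

(** A relation, because the lists of a configuration may end in any number of blanks while the tape
    function is unique. The head position is forgotten by [config] and must be carried
    separately. *)
Definition represents (M : TM) (c : config M) (ac : aconf M) : Prop :=
  let: (q, l, a, r) := c in
  let: (q', h, t) := ac in
  q = q' /\ forall z, t (h + z)%R = view l a r z.

Lemma step_represents (M : TM) (c : config M) (ac : aconf M) :
  represents c ac -> represents (step c) (astep ac).
Proof.
case: c => [[[q l] a] r]; case: ac => [[q' h] t] /= [<- Ht].
have Ha : t h = a by have := Ht 0%R; rewrite addr0.
rewrite /eff_delta Ha; case: ifP => _.
  split=> // z; rewrite -Ht /= addr0 /tupd -Ha; case: eqP => // ->; by [].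
case: (tm_delta M q a) => [[q1 w] mv].
case: mv => /=.
- case: l Ht => [|a' l] Ht; split=> // z; rewrite /tupd.
  + case: z => [[|[|k]]|k]; case: eqP => //= *; try lia.
    * by have -> : (h + -1 + 0 = h + Negz 0)%R by lia; rewrite Ht.
    * have -> : (h + -1 + k.+2 = h + k.+1)%R by lia. by rewrite Ht.
    * have -> : (h + -1 + Negz k = h + Negz k.+1)%R by lia. by rewrite Ht /= nth_nil.
  + case: z => [[|[|k]]|k]; case: eqP => //= *; try lia.
    * by have -> : (h + -1 + 0 = h + Negz 0)%R by lia; rewrite Ht.
    * have -> : (h + -1 + k.+2 = h + k.+1)%R by lia. by rewrite Ht.
    * have -> : (h + -1 + Negz k = h + Negz k.+1)%R by lia. by rewrite Ht.
- case: r Ht => [|a' r] Ht; split=> // z; rewrite /tupd.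
  + case: z => [[|k]|[|k]]; case: eqP => //= *; try lia.
    * have -> : (h + 1 + 0 = h + 1%N)%R by lia. by rewrite Ht.
    * have -> : (h + 1 + k.+1 = h + k.+2)%R by lia. by rewrite Ht /= nth_nil.
    * have -> : (h + 1 + Negz k.+1 = h + Negz k)%R by lia. by rewrite Ht.
  + case: z => [[|k]|[|k]]; case: eqP => //= *; try lia.
    * have -> : (h + 1 + 0 = h + 1%N)%R by lia. by rewrite Ht.
    * have -> : (h + 1 + k.+1 = h + k.+2)%R by lia. by rewrite Ht.
    * have -> : (h + 1 + Negz k.+1 = h + Negz k)%R by lia. by rewrite Ht.
- split=> // z; rewrite addr0 /tupd.
  case: z => [[|k]|k]; case: eqP => //= *; try lia.
  all: by rewrite Ht.
Qed.

Lemma run_represents (M : TM) n x : represents (run M n x) (arun M n x).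
Proof.
elim: n => [|n IHn]; last by rewrite /run /arun !iterS; exact: step_represents.
rewrite /run /arun /=; case: x => [|b x] /=; split=> // z; rewrite add0r.
  by case: z => [[|k]|k] //=; rewrite nth_nil.
case: z => [[|k]|k] //=; [by rewrite onthE | by rewrite nth_nil].
Qed.

Definition astate (M : TM) (c : aconf M) : tm_state M := c.1.1.

Lemma cstate_arun (M : TM) n x : cstate (run M n x) = astate (arun M n x).
Proof.
have := run_represents M n x.
by case: (run M n x) (arun M n x) => [[[q l] a] r] [[q' h] t] /= [->].
Qed.

(** The hypothesis at [k = size out] says that a blank follows the output, and this blank is where
    [read_bits] stops. *)
Lemma output_arun (M : TM) n x q h t out :
    arun M n x = (q, h, t) ->
    (forall k, t (h + Posz k)%R = onth out k) ->
  output M n x = out.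
Proof.
move=> E Ht; have := run_represents M n x; rewrite E /output.
case: (run M n x) => [[[q' l] a] r] /= [_ Hr].
have {Hr}Hr k : nth None (a :: r) k = onth out k.
  by rewrite -Ht Hr; case: k.
rewrite -[LHS]/(read_bits (a :: r)).
elim: out (a :: r) Hr {Ht} => [|b out IH] [|s w] Hw //.
- by move: (Hw 0) => /= ->.
- by move: (Hw 0).
- by move: (Hw 0) => /= ->; congr cons; apply: IH => k; exact: (Hw k.+1).
Qed.

(** * Composable machine fragments *)

(** A fragment is left by a transition without target state, not by reaching a halting state.
    Redirecting these transitions composes fragments at no extra step, so running times add up
    exactly. *)
Record fragment := Fragment {
  fstate : finType;
  fentry : fstate;
  fdelta : fstate -> sym -> option fstate * sym * move
}.

Inductive exits (M : fragment) : nat -> fstate M -> int -> tape -> int -> tape -> Prop :=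
| exits_now q h t w mv :
    fdelta q (t h) = (None, w, mv) ->
    exits 1 q h t (h + shift mv)%R (tupd t h w)
| exits_later n q h t w mv q' h' t' :
    fdelta q (t h) = (Some q', w, mv) ->
    exits n q' (h + shift mv)%R (tupd t h w) h' t' ->
    exits n.+1 q h t h' t'.

Definition runs (M : fragment) n := exits n (fentry M).

Definition atom (f : sym -> sym) (mv : move) : fragment :=
  @Fragment unit tt (fun _ s => (None, f s, mv)).

Lemma runs_atom f mv h t : runs (atom f mv) 1 h t (h + shift mv)%R (tupd t h (f (t h))).
Proof. exact: exits_now. Qed.

Definition fseq (A B : fragment) : fragment :=
  @Fragment (fstate A + fstate B)%type (inl (fentry A))
    (fun q s => match q with
      | inl a => let: (a', w, mv) := fdelta a s in
                 (Some (if a' is Some a1 then inl a1 else inr (fentry B)), w, mv)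
      | inr b => let: (b', w, mv) := fdelta b s in (omap inr b', w, mv)
      end).

Lemma runs_fseq A B n1 n2 h t h1 t1 h2 t2 :
  runs A n1 h t h1 t1 -> runs B n2 h1 t1 h2 t2 -> runs (fseq A B) (n1 + n2) h t h2 t2.
Proof.
move=> HA HB.
have {}HB : @exits (fseq A B) n2 (inr (fentry B)) h1 t1 h2 t2.
  rewrite /runs in HB; elim: HB => [q h0 t0 w mv E|n q h0 t0 w mv q' h' t' E _ IH].
    by apply: exits_now; rewrite /= E.
  by apply: exits_later IH; rewrite /= E.
rewrite /runs /= in HA *; elim: HA HB => [q h0 t0 w mv E|n q h0 t0 w mv q' h' t' E _ IH] HB.
  by rewrite add1n; apply: exits_later HB; rewrite /= E.
by rewrite addSn; apply: exits_later (IH HB); rewrite /= E.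
Qed.

Definition fif (p : sym -> bool) (A B : fragment) : fragment :=
  @Fragment (option (fstate A + fstate B)) None
    (fun q s => match q with
      | None => (Some (Some (if p s then inl (fentry A) else inr (fentry B))), s, Stay)
      | Some (inl a) => let: (a', w, mv) := fdelta a s in (omap (Some \o inl) a', w, mv)
      | Some (inr b) => let: (b', w, mv) := fdelta b s in (omap (Some \o inr) b', w, mv)
      end).

Lemma runs_fif (p : sym -> bool) A B n h t h' t' :
  runs (if p (t h) then A else B) n h t h' t' -> runs (fif p A B) n.+1 h t h' t'.
Proof.
case: ifP => Hp H.
all: apply: (@exits_later (fif p A B) n _ h t (t h) Stay); first by rewrite /= Hp.
all: rewrite addr0 tupd_id; move: H; rewrite /runs.
all: elim=> [q h0 t0 w mv E|{}n q h0 t0 w mv q' {}h' {}t' E _ IH].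
all: by [apply: exits_now; rewrite /= E | apply: exits_later IH; rewrite /= E].
Qed.

Definition fwhile (p : sym -> bool) (A : fragment) : fragment :=
  @Fragment (option (fstate A)) None
    (fun q s => match q with
      | None => (if p s then Some (Some (fentry A)) else None, s, Stay)
      | Some a => let: (a', w, mv) := fdelta a s in (Some a', w, mv)
      end).

Lemma runs_fwhile_stop (p : sym -> bool) A h t :
  ~~ p (t h) -> runs (fwhile p A) 1 h t h t.
Proof.
move=> Hp; have := @exits_now (fwhile p A) None h t (t h) Stay.
by rewrite /= (negbTE Hp) addr0 tupd_id; apply.
Qed.

Lemma runs_fwhile_iter (p : sym -> bool) A n1 n2 h t h1 t1 h2 t2 :
    p (t h) -> runs A n1 h t h1 t1 -> runs (fwhile p A) n2 h1 t1 h2 t2 ->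
  runs (fwhile p A) (n1 + n2).+1 h t h2 t2.
Proof.
move=> Hp HA HW.
apply: (@exits_later (fwhile p A) _ None h t (t h) Stay); first by rewrite /= Hp.
rewrite addr0 tupd_id; rewrite /runs in HA.
elim: HA HW => [q h0 t0 w mv E|n q h0 t0 w mv q' h' t' E _ IH] HW.
  by rewrite add1n; apply: exits_later HW; rewrite /= E.
by rewrite addSn; apply: exits_later (IH HW); rewrite /= E.
Qed.

Definition TM_of_fragment (M : fragment) : TM :=
  {| tm_state := option (fstate M);
     tm_start := Some (fentry M);
     tm_halt := fun q => ~~ isSome q;
     tm_accept := fun _ => true;
     tm_delta := fun q s => if q is Some a then fdelta a s else (None, s, Stay) |}.

Lemma iter_halted (M : TM) q h t n :
  tm_halt M q -> iter n (@astep M) (q, h, t) = (q, h, t).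
Proof.
move=> Hq; elim: n => // n IHn.
by rewrite iterS IHn /astep /eff_delta Hq addr0 tupd_id.
Qed.

Lemma arun_fragment M n N x h' t' :
  runs M n 0%R (tape_of_word x) h' t' -> n <= N ->
  arun (TM_of_fragment M) N x = (None, h', t').
Proof.
move=> H /subnK <-; rewrite /arun iterD.
have -> : iter n (@astep (TM_of_fragment M)) (tm_start (TM_of_fragment M), 0%R, tape_of_word x)
          = (None, h', t'); last by rewrite iter_halted.
move: H; rewrite /runs /=.
elim=> [q h t w mv E|{}n q h t w mv q' h1 t1 E _ IH].
  by rewrite /= /eff_delta /= E.
by rewrite iterSr -IH /= /eff_delta /= E.
Qed.

(** * Stacks on a tape *)

Definition flip (mv : move) : move :=
  match mv with MoveL => MoveR | MoveR => MoveL | Stay => Stay end.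

Lemma shift_flip mv : shift (flip mv) = (- shift mv)%R.
Proof. by case: mv. Qed.

Definition fnop : fragment := atom id Stay.

Lemma runs_fnop h t : runs fnop 1 h t h t.
Proof. by have := runs_atom id Stay h t; rewrite addr0 tupd_id. Qed.

Definition fwrite (s : sym) : fragment := atom (fun _ => s) Stay.

Lemma runs_fwrite s h t : runs (fwrite s) 1 h t h (tupd t h s).
Proof. by have := runs_atom (fun _ => s) Stay h t; rewrite addr0. Qed.

Fixpoint fmoves (mv : move) (n : nat) : fragment :=
  if n is n'.+1 then fseq (atom id mv) (fmoves mv n') else fnop.

Lemma runs_fmoves mv n h t : runs (fmoves mv n) n.+1 h t (h + shift mv * n%:Z)%R t.
Proof.
elim: n h => [|n IHn] h; first by rewrite mulr0 addr0; exact: runs_fnop.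
have H1 := runs_atom id mv h t; rewrite tupd_id in H1.
have := runs_fseq H1 (IHn _); rewrite add1n.
by have -> : (h + shift mv + shift mv * n = h + shift mv * n.+1)%R by lia.
Qed.

Definition fwalk (mv : move) (n : nat) : fragment := fwhile (@isSome bool) (fmoves mv n).

Lemma runs_fwalk mv n k h t :
    (forall j, j < k -> isSome (t (h + shift mv * (n * j)%:Z)%R)) ->
    t (h + shift mv * (n * k)%:Z)%R = None ->
  runs (fwalk mv n) (k * n.+2).+1 h t (h + shift mv * (n * k)%:Z)%R t.
Proof.
elim: k h => [|k IHk] h Hs Hn.
  by rewrite muln0 mulr0 addr0 in Hn *; apply: runs_fwhile_stop; rewrite Hn.
have H0 : isSome (t h) by have := Hs 0 isT; rewrite muln0 mulr0 addr0.
have E j : (h + shift mv * n%:Z + shift mv * (n * j)%:Z = h + shift mv * (n * j.+1)%:Z)%R by lia.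
have := IHk (h + shift mv * n%:Z)%R; rewrite E => {}IHk.
have -> : k.+1 * n.+2 = n.+1 + (k * n.+2).+1 by lia.
apply: (runs_fwhile_iter H0 (runs_fmoves mv n h t)).
by apply: IHk => // j Hj; rewrite E; apply: Hs.
Qed.

(* The elements of [s] are listed from the bottom of the stack, starting next to
   the base cell, which stays blank. *)
Definition stack_at (t : tape) (p d : int) (s : seq bool) : Prop :=
  forall j : nat, t (p + d * j%:Z)%R = if j is k.+1 then onth s k else None.

Lemma onthSome (s : seq bool) j : j < size s -> isSome (onth s j).
Proof. by rewrite onthTE. Qed.

Definition fpush (mv : move) (n : nat) (b : bool) : fragment :=
  fseq (fmoves mv n) (fseq (fwalk mv n) (fseq (fwrite (Some b))
    (fseq (fmoves (flip mv) n) (fwalk (flip mv) n)))).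

Definition fdown (mv : move) (n : nat) : fragment :=
  fseq (fmoves (flip mv) n) (fwalk (flip mv) n).

(** The first move is made without looking at the starting cell, which may thus be filled (after a
    push) or just erased (after a pop); the blank base cell stops the walk. *)
Lemma runs_fdown mv n p t k :
    (forall j, 0 < j -> j < k -> isSome (t (p + shift mv * (n * j)%:Z)%R)) ->
    t p = None -> 0 < k ->
  runs (fdown mv n) (n.+1 + (k.-1 * n.+2).+1) (p + shift mv * (n * k)%:Z)%R t p t.
Proof.
move=> Hs Hp Hk.
apply: (runs_fseq (runs_fmoves _ _ _ _)); rewrite shift_flip.
set h := (_ + _)%R.
have E j : j <= k.-1 -> (h + shift (flip mv) * (n * j)%:Z = p + shift mv * (n * (k.-1 - j))%:Z)%R.
  move=> Hj; have Ei : k = (j + (k.-1 - j)).+1 by lia.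
  by rewrite /h shift_flip {1}Ei; move: (k.-1 - j) => i; lia.
have := @runs_fwalk (flip mv) n k.-1 h t; rewrite E // subnn muln0 mulr0 addr0.
apply=> // j Hj; rewrite E; [apply: Hs; lia | lia].
Qed.

(** The walk overshoots the top by one stride and steps back. On an empty stack it therefore ends on
    the base cell, and reading a blank there is the test for emptiness. *)
Definition ftop (mv : move) (n : nat) : fragment :=
  fseq (fmoves mv n) (fseq (fwalk mv n) (fmoves (flip mv) n)).

Section StackAt.
Variables (mv : move) (n : nat) (p : int) (t : tape) (s : seq bool).
Hypothesis stack_t : stack_at t p (shift mv * n%:Z)%R s.

Let cell (j : nat) : t (p + shift mv * (n * j)%:Z)%R = if j is k.+1 then onth s k else None.
Proof. by rewrite -stack_t; congr t; lia. Qed.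

Let base : t p = None.
Proof. by have := cell 0; rewrite muln0 mulr0 addr0. Qed.

Lemma runs_ftop :
  runs (ftop mv n) (n.+1 + ((size s * n.+2).+1 + n.+1)) p t
    (p + shift mv * (n * size s)%:Z)%R t.
Proof.
have E j : (p + shift mv * n%:Z + shift mv * (n * j)%:Z = p + shift mv * (n * j.+1)%:Z)%R by lia.
apply: (runs_fseq (runs_fmoves _ _ _ _)).
apply: (@runs_fseq _ _ _ _ _ _ (p + shift mv * (n * (size s).+1)%:Z)%R t).
  have := @runs_fwalk mv n (size s) (p + shift mv * n%:Z)%R t; rewrite E; apply.
    by move=> j Hj; rewrite E cell; apply: onthSome.
  by rewrite cell onth_default.
have := runs_fmoves (flip mv) n (p + shift mv * (n * (size s).+1)%:Z)%R t.
rewrite shift_flip.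
by have -> : (p + shift mv * (n * (size s).+1)%N + - shift mv * n = p + shift mv * (n * size s)%N)%R by lia.
Qed.

Lemma runs_fpush b : 0 < n -> mv <> Stay ->
  runs (fpush mv n b)
    (n.+1 + ((size s * n.+2).+1 + (1 + (n.+1 + (size s * n.+2).+1)))) p t p
    (tupd t (p + shift mv * (n * (size s).+1)%:Z)%R (Some b)).
Proof.
move=> Hn Hmv.
have E j : (p + shift mv * n%:Z + shift mv * (n * j)%:Z = p + shift mv * (n * j.+1)%:Z)%R by lia.
apply: (runs_fseq (runs_fmoves _ _ _ _)).
apply: (@runs_fseq _ _ _ _ _ _ (p + shift mv * (n * (size s).+1)%:Z)%R t).
  have := @runs_fwalk mv n (size s) (p + shift mv * n%:Z)%R t; rewrite E; apply.
    by move=> j Hj; rewrite E cell; apply: onthSome.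
  by rewrite cell onth_default.
apply: (runs_fseq (runs_fwrite _ _ _)).
apply: (@runs_fdown mv n p _ (size s).+1) => //.
  move=> j Hj0 Hj; rewrite /tupd; case: eqP => // _; rewrite cell.
  by case: j Hj0 Hj => // j _ Hj; apply: onthSome.
rewrite /tupd base; case: eqP => // E0; exfalso.
have {E0} : (shift mv * (n * (size s).+1)%:Z = 0)%R by lia.
by case: mv Hmv => //= _; lia.
Qed.

Lemma runs_erase : 0 < n -> mv <> Stay -> 0 < size s ->
  runs (fseq (fwrite None) (fdown mv n)) (1 + (n.+1 + ((size s).-1 * n.+2).+1))
    (p + shift mv * (n * size s)%:Z)%R t p (tupd t (p + shift mv * (n * size s)%:Z)%R None).
Proof.
move=> Hn Hmv Hs.
apply: (runs_fseq (runs_fwrite _ _ _)).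
apply: runs_fdown => //; last by rewrite /tupd base; case: eqP.
move=> j Hj0 Hj; rewrite /tupd; case: eqP => [E0|_].
  exfalso; have {E0} : (shift mv * (n * j)%:Z = shift mv * (n * size s)%:Z)%R by lia.
  have {}Hj : n * j < n * size s by rewrite ltn_pmul2l.
  by case: mv Hmv => //= _; lia.
by rewrite cell; case: j Hj0 Hj => // j _ Hj; apply: onthSome; lia.
Qed.

End StackAt.

(** * Register programs *)

Definition regs := nat -> seq bool.

Definition setreg (S : regs) (i : nat) (s : seq bool) : regs :=
  fun j => if j == i then s else S j.

(** [Case] and [Loop] consume the bit that they inspect, so a loop is driven by the contents of a
    register; its body may push onto that register again. *)
Inductive cmd :=
| Skip
| Push (i : nat) (b : bool)
| Case (i : nat) (ce cf ct : cmd)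
| Loop (i : nat) (cf ct : cmd)
| Then (c1 c2 : cmd).

Inductive exec : cmd -> regs -> nat -> regs -> Prop :=
| exec_Skip S : exec Skip S 1 S
| exec_Push S i b : exec (Push i b) S 1 (setreg S i (b :: S i))
| exec_Case_nil S i ce cf ct n S' :
    S i = [::] -> exec ce S n S' -> exec (Case i ce cf ct) S n.+1 S'
| exec_Case_cons S i ce cf ct b s n S' :
    S i = b :: s -> exec (if b then ct else cf) (setreg S i s) n S' ->
    exec (Case i ce cf ct) S n.+1 S'
| exec_Loop_nil S i cf ct : S i = [::] -> exec (Loop i cf ct) S 1 S
| exec_Loop_cons S i cf ct b s n1 S1 n2 S2 :
    S i = b :: s -> exec (if b then ct else cf) (setreg S i s) n1 S1 ->
    exec (Loop i cf ct) S1 n2 S2 ->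
    exec (Loop i cf ct) S (n1 + n2).+1 S2
| exec_Then S c1 c2 n1 S1 n2 S2 :
    exec c1 S n1 S1 -> exec c2 S1 n2 S2 -> exec (Then c1 c2) S (n1 + n2).+1 S2.

Lemma exec_gt0 c S n S' : exec c S n S' -> 0 < n.
Proof. by case. Qed.

(** Only [Push] enlarges a register, by one bit per unit of time. This turns every time bound into a
    bound on stack heights and on output length. *)
Lemma exec_size c S n S' i : exec c S n S' -> size (S' i) <= size (S i) + n.
Proof.
elim=> {c S n S'}.
- by move=> S; lia.
- by move=> S j b; rewrite /setreg; case: eqP => [->|_] /=; lia.
- by move=> S j ce cf ct n S' _ _; lia.
- move=> S j ce cf ct b s n S' Hj _; rewrite /setreg; case: eqP => [->|_]; last by lia.
  by rewrite Hj /=; lia.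
- by move=> S j cf ct _; lia.
- move=> S j cf ct b s n1 S1 n2 S2 Hj _; rewrite /setreg; case: eqP => [->|_] H1 _; last by lia.
  by rewrite Hj /=; lia.
- by move=> S c1 c2 n1 S1 n2 S2 _ H1 _ H2; lia.
Qed.

Fixpoint max_reg (c : cmd) : nat :=
  match c with
  | Skip => 0
  | Push i _ => i
  | Case i ce cf ct => maxn i (maxn (max_reg ce) (maxn (max_reg cf) (max_reg ct)))
  | Loop i cf ct => maxn i (maxn (max_reg cf) (max_reg ct))
  | Then c1 c2 => maxn (max_reg c1) (max_reg c2)
  end.

(* Register 0 occupies the cells to the right of cell -1; registers 1, ..., r are
   interleaved to the left of it, register i having base cell -i and stride r. *)
Definition tape_of (r : nat) (S : regs) : tape :=
  fun z => match z with
           | Posz k => onth (rev (S 0)) k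
           | Negz k => if k < r then None else onth (rev (S (k %% r).+1)) (k %/ r).-1
           end.

Definition rmove (i : nat) : move := if i == 0 then MoveR else MoveL.
Definition rstride (r i : nat) : nat := if i == 0 then 1 else r.

Notation home := (Negz 0).

(** Registers 0 and 1 share the base cell -1 and grow in opposite directions, hence the predecessor
    [i.-1]. The others are told apart by their residues modulo [r]. *)
Lemma stack_tape_of r S i : 0 < r -> i <= r ->
  stack_at (tape_of r S) (Negz i.-1) (shift (rmove i) * (rstride r i)%:Z)%R (rev (S i)).
Proof.
move=> Hr Hi j; case: i Hi => [|i] Hi /=.
  rewrite /rmove /rstride /=; case: j => [|j].
    by rewrite mulr0 addr0 /= Hr.
  by have -> : (Negz 0 + 1%:Z * 1%:Z * j.+1%:Z = Posz j)%R by lia.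
rewrite /rmove /rstride /=.
have -> : (Negz i + (- 1) * r%:Z * j%:Z = Negz (i + r * j))%R by lia.
case: j => [|j] /=; first by rewrite muln0 addn0 Hi.
rewrite mulnS addnCA [r + _]addnC ltnNge leq_addl /=.
have -> : (i + r * j + r) = (j.+1 * r + i) by lia.
by rewrite modnMDl divnMDl // modn_small // divn_small // addn0.
Qed.

(** The hypothesis only asks that the two stacks, read as partial functions, differ at height [k];
    this covers a push ([w] a bit) and a pop ([w] blank) at once. *)
Lemma tupd_tape_of r S i k w s : 0 < r -> i <= r ->
    (forall j, onth (rev s) j = if j == k then w else onth (rev (S i)) j) ->
  tupd (tape_of r S) (Negz i.-1 + shift (rmove i) * (rstride r i * k.+1)%:Z)%R w
  = tape_of r (setreg S i s).
Proof.
move=> Hr Hi Hs; apply: functional_extensionality => z; rewrite /tupd.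
case: i Hi Hs => [|i] Hi Hs; rewrite /rmove /rstride /=.
  have -> : (Negz 0 + 1%:Z * (1 * k.+1)%:Z = Posz k)%R by lia.
  case: z => z /=; last by rewrite /setreg.
  by rewrite /setreg /= Hs; case: (z =P k) => [->|Hz]; [rewrite eqxx | case: eqP => // -[]].
have -> : (Negz i + (- 1) * (r * k.+1)%:Z = Negz (i + r * k.+1))%R by lia.
case: z => z /=; first by rewrite /setreg.
have [Hz|Hz] := ltnP z r.
  by case: eqP => // -[Ez]; exfalso; rewrite Ez mulnS in Hz; lia.
rewrite /setreg eqSS; case: (Negz z =P Negz (i + r * k.+1)) => [[->]|Nz].
  have -> : (i + r * k.+1) = (k.+1 * r + i) by lia.
  by rewrite modnMDl divnMDl // modn_small // divn_small // addn0 eqxx Hs eqxx.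
case: (z %% r =P i) => // Ezi; rewrite Hs.
case: ((z %/ r).-1 =P k) => [E|]; last by rewrite Ezi.
exfalso; apply: Nz; congr Negz.
have := divn_eq z r; rewrite Ezi.
have : 0 < z %/ r by rewrite divn_gt0.
by move: E; case: (z %/ r) => //= m -> _ ->; lia.
Qed.

(** * Compiling register programs to a single tape *)

Section Compile.
Variable r : nat.
Hypothesis r_gt0 : 0 < r.

Definition fgo (i : nat) : fragment := fmoves MoveL i.-1.
Definition fback (i : nat) : fragment := fmoves MoveR i.-1.
Definition fgotop (i : nat) : fragment := fseq (fgo i) (ftop (rmove i) (rstride r i)).
Definition ftake (i : nat) (A : fragment) : fragment :=
  fseq (fseq (fwrite None) (fdown (rmove i) (rstride r i))) (fseq (fback i) A).

Definition fbranch (i : nat) (A B : fragment) : fragment :=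
  fif (fun s => s == Some false) (ftake i A) (ftake i B).

(** The loop test reads the cell under the head, so each round must end on the top cell of register
    [i], wherever the body has left that top. *)
Definition fscan (i : nat) (A B : fragment) : fragment :=
  fwhile (@isSome bool) (fseq (fbranch i A B) (fgotop i)).

Fixpoint compile (c : cmd) : fragment :=
  match c with
  | Skip => fnop
  | Push i b => fseq (fgo i) (fseq (fpush (rmove i) (rstride r i) b) (fback i))
  | Case i ce cf ct =>
      fseq (fgotop i) (fif (fun s => ~~ isSome s) (fseq (fback i) (compile ce))
                        (fbranch i (compile cf) (compile ct)))
  | Loop i cf ct =>
      fseq (fgotop i) (fseq (fscan i (compile cf) (compile ct)) (fback i))
  | Then c1 c2 => fseq (compile c1) (compile c2)
  end.

Definition top_cell (S : regs) (i : nat) : int :=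
  (Negz i.-1 + shift (rmove i) * (rstride r i * size (S i))%:Z)%R.

Lemma rmove_neq i : rmove i <> Stay.
Proof. by rewrite /rmove; case: eqP. Qed.

Lemma rstride_gt0 i : 0 < rstride r i.
Proof. by rewrite /rstride; case: eqP. Qed.

Lemma rstride_le i : rstride r i <= r.
Proof. by rewrite /rstride; case: eqP. Qed.

Lemma runs_fgo i t : runs (fgo i) i.-1.+1 home t (Negz i.-1) t.
Proof.
have := runs_fmoves MoveL i.-1 home t.
by have -> : (home + shift MoveL * i.-1%:Z = Negz i.-1)%R by rewrite /=; lia.
Qed.

Lemma runs_fback i t : runs (fback i) i.-1.+1 (Negz i.-1) t home t.
Proof.
have := runs_fmoves MoveR i.-1 (Negz i.-1) t.
by have -> : (Negz i.-1 + shift MoveR * i.-1%:Z = home)%R by rewrite /=; lia.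
Qed.

Lemma tape_top_cell S i : i <= r -> tape_of r S (top_cell S i) = ohead (S i).
Proof.
move=> Hi; rewrite /top_cell.
have -> : (Negz i.-1 + shift (rmove i) * (rstride r i * size (S i))%:Z
  = Negz i.-1 + shift (rmove i) * (rstride r i)%:Z * (size (S i))%:Z)%R by lia.
rewrite stack_tape_of //; case: (S i) => //= b s.
by rewrite rev_cons -cats1 onth_cat size_rev ltnn subnn.
Qed.

(** A generous price for one trip to a stack of height at most [B] with stride at most [r]. The trip
    lemmas bound twice the time, so that the two trips of one loop round fit into a single unit. *)
Definition op_time (B : nat) : nat := 10 * (r + 3) * (B + 3).

Lemma runs_fgotop S i B : i <= r -> size (S i) <= B ->
  exists2 t, 2 * t <= op_time B &
    runs (fgotop i) t home (tape_of r S) (top_cell S i) (tape_of r S).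
Proof.
move=> Hi HB.
have := runs_ftop (stack_tape_of S r_gt0 Hi); rewrite size_rev => H.
eexists; last by apply: runs_fseq (runs_fgo _ _) H.
rewrite /op_time; have := rstride_le i; move: (rstride r i) => d Hd.
have : size (S i) * d.+2 <= B * r.+2 by apply: leq_mul.
by nia.
Qed.

Lemma runs_ftake S i b s A n h t B : i <= r -> S i = b :: s -> size (S i) <= B ->
    runs A n home (tape_of r (setreg S i s)) h t ->
  exists2 m, 2 * m <= op_time B + 2 * n - 2 &
    runs (ftake i A) m (top_cell S i) (tape_of r S) h t.
Proof.
move=> Hi HS HB HA.
have Hs : 0 < size (rev (S i)) by rewrite size_rev HS.
have := runs_erase (stack_tape_of S r_gt0 Hi) (rstride_gt0 i) (rmove_neq (i := i)) Hs.
rewrite size_rev {3}HS [size (b :: s)]/= (@tupd_tape_of _ _ _ _ _ s) //; last first.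
  move=> j; rewrite HS rev_cons -cats1 onth_cat size_rev.
  case: eqP => [->|Hj]; first by rewrite onth_default ?size_rev.
  case: ltnP => // Hj'; rewrite onth_default ?size_rev //.
  by rewrite onth_default //=; lia.
move=> H; eexists; last by apply: runs_fseq H (runs_fseq (runs_fback _ _) HA).
rewrite /op_time; have := rstride_le i; move: (rstride r i) => d Hd.
have : (size (S i)).-1 * d.+2 <= B * r.+2 by apply: leq_mul => //; lia.
by nia.
Qed.

Lemma runs_fbranch S i b s A C n h t B : i <= r -> S i = b :: s -> size (S i) <= B ->
    runs (if b then C else A) n home (tape_of r (setreg S i s)) h t ->
  exists2 m, 2 * m <= op_time B + 2 * n &
    runs (fbranch i A C) m (top_cell S i) (tape_of r S) h t.
Proof.
move=> Hi HS HB HA.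
have [m Hm H] := runs_ftake Hi HS HB HA.
exists m.+1; first by move: Hm; rewrite /op_time; nia.
by apply: runs_fif; rewrite tape_top_cell // HS /=; case: b H {HA HS}.
Qed.

(** Unfolding a loop leads back to its scan, entered at the top cell, and not to the whole compiled
    loop; the second conjunct is the induction hypothesis for this. The unit saved in [(2 * n).-1]
    pays for going to the top beforehand and for returning home afterwards. *)
Lemma runs_compile c S n S' B : exec c S n S' -> max_reg c <= r ->
    (forall i, size (S i) + n <= B) ->
  (exists2 t, t <= 2 * n * op_time B &
     runs (compile c) t home (tape_of r S) home (tape_of r S')) /\
  (if c is Loop i cf ct then
     exists2 t, t <= (2 * n).-1 * op_time B &
       runs (fscan i (compile cf) (compile ct)) t (top_cell S i) (tape_of r S)
         (Negz i.-1) (tape_of r S')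
   else True).
Proof.
have K0 : 8 < op_time B by rewrite /op_time; nia.
have Kr : 2 * r + 2 <= op_time B by rewrite /op_time; nia.
have full i cf ct S0 n0 S1 : i <= r -> (forall i, size (S0 i) + n0 <= B) -> 0 < n0 ->
  (exists2 t, t <= (2 * n0).-1 * op_time B &
       runs (fscan i (compile cf) (compile ct)) t (top_cell S0 i) (tape_of r S0)
         (Negz i.-1) (tape_of r S1)) ->
  (exists2 t, t <= 2 * n0 * op_time B &
     runs (compile (Loop i cf ct)) t home (tape_of r S0) home (tape_of r S1)).
  move=> Hi HB Hn [t Ht H].
  have [|u Hu Hg] := runs_fgotop (S := S0) (B := B) Hi; first by have := HB i; lia.
  eexists; last by apply: runs_fseq Hg (runs_fseq H (runs_fback _ _)).
  have -> : 2 * n0 = (2 * n0).-1.+1 by lia.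
  by rewrite mulSn; lia.
elim=> {c S n S'}.
- move=> S _ _; split=> //; exists 1; last exact: runs_fnop.
  by lia.
- move=> S i b /= Hi HB; split=> //.
  have := runs_fpush (stack_tape_of S r_gt0 Hi) b (rstride_gt0 i) (rmove_neq (i := i)).
  rewrite size_rev (@tupd_tape_of _ _ _ _ _ (b :: S i)) //; last first.
    move=> j; rewrite rev_cons -cats1 onth_cat size_rev.
    case: eqP => [->|Hj]; first by rewrite ltnn subnn.
    by case: ltnP => // Hj'; rewrite !onth_default ?size_rev //=; lia.
  move=> H; eexists; last by apply: runs_fseq (runs_fgo _ _) (runs_fseq H (runs_fback _ _)).
  rewrite /op_time; have := rstride_le i; move: (rstride r i) => d Hd.
  have : size (S i) * d.+2 <= B * r.+2 by apply: leq_mul => //; have := HB i; lia.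
  by nia.
- move=> S i ce cf ct n S' HS _ IH /=; rewrite !geq_max => /andP[Hi /andP[He _]] HB.
  split=> //; have [|[t Ht H] _] := IH He; first by move=> j; have := HB j; lia.
  have [|u Hu Hg] := runs_fgotop (S := S) (B := B) Hi; first by have := HB i; lia.
  eexists; last first.
    apply: runs_fseq Hg (runs_fif _); rewrite tape_top_cell // HS /=.
    have -> : top_cell S i = Negz i.-1 by rewrite /top_cell HS muln0 mulr0 addr0.
    exact: runs_fseq (runs_fback _ _) H.
  by rewrite mulnS mulnDl; lia.
- move=> S i ce cf ct b s n S' HS _ IH /=; rewrite !geq_max => /and4P[Hi _ Hf Ht] HB.
  split=> //; have [||[t Hnt H] _] := IH; first by case: (b).
    move=> j; rewrite /setreg; case: eqP => [_|_]; last by have := HB j; lia.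
    by have := HB i; rewrite HS /=; lia.
  have HBi : size (S i) <= B by have := HB i; lia.
  have [u Hu Hg] := runs_fgotop Hi HBi.
  have H' : runs (if b then compile ct else compile cf) t home
    (tape_of r (setreg S i s)) home (tape_of r S') by case: (b) H.
  have [m Hm Hb] := runs_fbranch Hi HS HBi H'.
  eexists; last first.
    by apply: runs_fseq Hg (runs_fif _); rewrite tape_top_cell // HS /=; exact: Hb.
  by rewrite mulnS mulnDl; lia.
- move=> S i cf ct HS /=; rewrite geq_max => /andP[Hi _] HB.
  have H : runs (fscan i (compile cf) (compile ct)) 1 (top_cell S i) (tape_of r S)
         (Negz i.-1) (tape_of r S).
    have <- : top_cell S i = Negz i.-1 by rewrite /top_cell HS muln0 mulr0 addr0.
    by apply: runs_fwhile_stop; rewrite tape_top_cell // HS.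
  have Hw : exists2 t, t <= (2 * 1).-1 * op_time B &
    runs (fscan i (compile cf) (compile ct)) t (top_cell S i) (tape_of r S)
         (Negz i.-1) (tape_of r S) by exists 1; [lia|].
  by split=> //; exact: (full i cf ct).
- move=> S i cf ct b s n1 S1 n2 S2 HS E1 IH1 E2 IH2 /=; rewrite !geq_max => /and3P[Hi Hf Ht] HB.
  have HB1 j : size (setreg S i s j) + n1 <= B.
    rewrite /setreg; case: eqP => [_|_]; last by have := HB j; lia.
    by have := HB i; rewrite HS /=; lia.
  have HB2 j : size (S1 j) + n2 <= B.
    have := exec_size j E1; rewrite /setreg; case: eqP => [->|_]; last by have := HB j; lia.
    by have := HB i; rewrite HS /=; lia.
  have [||[t Hnt H] _] := IH1 => //; first by case: (b).
  have [||_ [u Hnu Hu]] := IH2 => //; first by rewrite /= !geq_max Hi Hf.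
  have HBi : size (S i) <= B by have := HB i; lia.
  have H' : runs (if b then compile ct else compile cf) t home
    (tape_of r (setreg S i s)) home (tape_of r S1) by case: (b) H.
  have [m Hm Hb] := runs_fbranch Hi HS HBi H'.
  have [|v Hv Hg] := runs_fgotop (S := S1) (B := B) Hi; first by have := HB2 i; lia.
  have Hw : exists2 t, t <= (2 * (n1 + n2).+1).-1 * op_time B &
    runs (fscan i (compile cf) (compile ct)) t (top_cell S i) (tape_of r S)
         (Negz i.-1) (tape_of r S2).
    eexists; last first.
      apply: runs_fwhile_iter (runs_fseq Hb Hg) Hu.
      by rewrite tape_top_cell // HS.
    have := exec_gt0 E2; move: Hnt Hnu Hm Hv K0; move: (op_time B) => K.
    by case: n2 {E2 IH2 HB HB2} => // n2; nia.
  by split=> //; apply: (full i cf ct).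
- move=> S c1 c2 n1 S1 n2 S2 E1 IH1 E2 IH2 /=; rewrite geq_max => /andP[H1 H2] HB.
  have [||[t Ht Hr1] _] := IH1 => //; first by move=> i; have := HB i; lia.
  have [||[u Hu Hr2] _] := IH2 => //.
    by move=> i; have := HB i; have := exec_size i E1; lia.
  split=> //; eexists; last by apply: runs_fseq Hr1 Hr2.
  by nia.
Qed.

End Compile.

(** * Polynomial time functions *)

(** Monotonicity is included because bounds get composed and a loop replaces the sizes of all its
    rounds by the largest one. *)
Definition poly (p : nat -> nat) : Prop :=
  {homo p : m n / m <= n} /\ exists c k, forall n, p n <= c * n.+1 ^ k.

Lemma leq_expl m n e : m <= n -> m ^ e <= n ^ e.
Proof. by case: e => // e; rewrite leq_exp2r. Qed.

Lemma poly_const a : poly (fun _ => a).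
Proof. by split=> //; exists a, 0 => n; rewrite expn0 muln1. Qed.

Lemma poly_id : poly id.
Proof. by split=> //; exists 1, 1 => n; rewrite expn1 mul1n. Qed.

Lemma poly_add p q : poly p -> poly q -> poly (fun n => p n + q n).
Proof.
move=> [Hp [c [k Hc]]] [Hq [d [l Hd]]]; split=> [m n Hmn|].
  by apply: leq_add; [apply: Hp | apply: Hq].
exists (c + d), (k + l) => n; rewrite mulnDl; apply: leq_add.
  by apply: leq_trans (Hc n) _; rewrite leq_mul2l leq_pexp2l ?orbT // leq_addr.
by apply: leq_trans (Hd n) _; rewrite leq_mul2l leq_pexp2l ?orbT // leq_addl.
Qed.

Lemma poly_mul p q : poly p -> poly q -> poly (fun n => p n * q n).
Proof.
move=> [Hp [c [k Hc]]] [Hq [d [l Hd]]]; split=> [m n Hmn|].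
  by apply: leq_mul; [apply: Hp | apply: Hq].
by exists (c * d), (k + l) => n; rewrite expnD mulnACA; apply: leq_mul.
Qed.

Lemma poly_comp p q : poly p -> poly q -> poly (fun n => p (q n)).
Proof.
move=> [Hp [c [k Hc]]] [Hq [d [l Hd]]]; split=> [m n Hmn|].
  by apply/Hp/Hq.
exists (c * d.+1 ^ k), (l * k) => n; apply: leq_trans (Hc _) _.
rewrite -mulnA leq_mul2l expnM -expnMn; apply/orP; right.
apply: leq_expl; rewrite mulSn; have := Hd n.
have : 0 < n.+1 ^ l by rewrite expn_gt0.
lia.
Qed.

Lemma poly_pbound p : poly p -> exists c k, forall n, p n <= pbound c k n.
Proof.
(* The factor [2 ^ k] comes from [n.+1 <= 2 * n] for positive [n]; the additive constant of [pbound]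
   takes care of [n = 0]. *)
case=> _ [c [k H]]; exists (c * 2 ^ k), k => n; apply: leq_trans (H n) _.
rewrite /pbound; case: n => [|n]; first by rewrite exp1n; have := expn_gt0 2 k; nia.
apply: leq_trans (leq_addr _ _); rewrite -mulnA -expnMn leq_mul2l.
by apply/orP; right; apply: leq_expl; lia.
Qed.

(** * Time bounds for elementary register programs *)

Definition cost (c : cmd) (S : regs) (b : nat) (S' : regs) : Prop :=
  exists2 n, n <= b & exec c S n S'.

Lemma cost_le c S b b' S' : cost c S b S' -> b <= b' -> cost c S b' S'.
Proof. by case=> n Hn H Hb; exists n => //; apply: leq_trans Hb. Qed.

Lemma cost_conv c S b b' S' S'' : cost c S b S' -> b <= b' -> S' = S'' -> cost c S b' S''.
Proof. by move=> H Hb <-; apply: cost_le H Hb. Qed.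

Lemma cost_Then c1 c2 S b1 S1 b2 S2 :
  cost c1 S b1 S1 -> cost c2 S1 b2 S2 -> cost (Then c1 c2) S (b1 + b2).+1 S2.
Proof.
case=> n Hn H1 [m Hm H2]; exists (n + m).+1; last exact: exec_Then H1 H2.
by rewrite ltnS leq_add.
Qed.

Lemma cost_Push S i b : cost (Push i b) S 1 (setreg S i (b :: S i)).
Proof. by exists 1 => //; exact: exec_Push. Qed.

Lemma cost_Skip S : cost Skip S 1 S.
Proof. by exists 1 => //; exact: exec_Skip. Qed.

Lemma cost_Case_nil S i ce cf ct b S' :
  S i = [::] -> cost ce S b S' -> cost (Case i ce cf ct) S b.+1 S'.
Proof. by move=> HS [n Hn H]; exists n.+1 => //; apply: exec_Case_nil. Qed.

Lemma cost_Case_cons S i ce cf ct x s b S' :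
    S i = x :: s -> cost (if x then ct else cf) (setreg S i s) b S' ->
  cost (Case i ce cf ct) S b.+1 S'.
Proof. by move=> HS [n Hn H]; exists n.+1 => //; apply: exec_Case_cons HS H. Qed.

Lemma cost_Loop_nil S i cf ct : S i = [::] -> cost (Loop i cf ct) S 1 S.
Proof. by move=> HS; exists 1 => //; apply: exec_Loop_nil. Qed.

Lemma cost_Loop_cons S i cf ct x s b1 S1 b2 S2 :
    S i = x :: s -> cost (if x then ct else cf) (setreg S i s) b1 S1 ->
    cost (Loop i cf ct) S1 b2 S2 ->
  cost (Loop i cf ct) S (b1 + b2).+1 S2.
Proof.
move=> HS [n Hn H1] [m Hm H2]; exists (n + m).+1; last exact: exec_Loop_cons HS H1 H2.
by rewrite ltnS leq_add.
Qed.

Lemma setreg_id S i s : S i = s -> setreg S i s = S.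
Proof. by move=> <-; apply: functional_extensionality => j; rewrite /setreg; case: eqP => [->|]. Qed.

Ltac regs_eq :=
  apply: functional_extensionality => ?; rewrite /setreg;
  repeat match goal with |- context [?x == ?y] => case: (x =P y) => ? end;
  try done; try congruence; try lia.

Definition clear (i : nat) : cmd := Loop i Skip Skip.

Lemma cost_clear S i : cost (clear i) S (2 * size (S i) + 1) (setreg S i [::]).
Proof.
move: {2}(S i) (erefl (S i)) => s; elim: s S => [|b s IHs] S HS.
  rewrite setreg_id //; apply: cost_le (cost_Loop_nil _ _ HS) _; lia.
have HS' : setreg S i s i = s by rewrite /setreg eqxx.
apply: (@cost_le _ _ (1 + (2 * size s + 1)).+1); last by rewrite HS /=; lia.
apply: (cost_Loop_cons HS); first by case: (b); exact: cost_Skip.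
have := IHs (setreg S i s) HS'; rewrite HS'.
by have -> : setreg (setreg S i s) i [::] = setreg S i [::] by regs_eq.
Qed.

Definition transfer (i j : nat) : cmd := Loop i (Push j false) (Push j true).

Lemma cost_transfer S i j : i != j ->
  cost (transfer i j) S (2 * size (S i) + 1) (setreg (setreg S j (catrev (S i) (S j))) i [::]).
Proof.
move=> /eqP Hij; move: {2}(S i) (erefl (S i)) => s; elim: s S => [|b s IHs] S HS.
  rewrite HS /= (setreg_id (i := j)) // setreg_id //; apply: cost_le (cost_Loop_nil _ _ HS) _; lia.
apply: (@cost_le _ _ (1 + (2 * size s + 1)).+1); last by rewrite HS /=; lia.
apply: (cost_Loop_cons (S1 := setreg (setreg S i s) j (b :: S j)) HS).
  have <- : setreg S i s j = S j by rewrite /setreg; case: eqP => // E; case: Hij.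
  by case: (b); exact: cost_Push.
set S1 := setreg _ _ _.
have E1 : S1 i = s by rewrite /S1 /setreg eqxx; case: eqP.
have E2 : S1 j = b :: S j by rewrite /S1 /setreg eqxx.
have := IHs S1 E1; rewrite E1 E2 HS /=.
by have -> : setreg (setreg S1 j (catrev s (b :: S j))) i [::] =
  setreg (setreg S j (catrev s (b :: S j))) i [::] by rewrite /S1; regs_eq.
Qed.

Definition prepend (i t j : nat) : cmd := Then (transfer i t) (transfer t j).

Lemma cost_prepend S i t j : i != t -> t != j -> i != j -> S t = [::] ->
  cost (prepend i t j) S (4 * size (S i) + 3)
    (setreg (setreg S j (S i ++ S j)) i [::]).
Proof.
move=> Hit Htj Hij Ht.
have H1 := cost_transfer S Hit; rewrite Ht in H1.
set S1 := setreg _ i _ in H1.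
have E1 : S1 t = rev (S i) by rewrite /S1 /setreg eq_sym (negbTE Hit) eqxx catrevE cats0.
have E2 : S1 j = S j by rewrite /S1 /setreg ![j == _]eq_sym (negbTE Htj) (negbTE Hij).
have H2 := cost_transfer S1 Htj.
rewrite E1 E2 catrevE revK size_rev in H2.
apply: cost_le (cost_Then H1 _) _.
- have -> : setreg (setreg S j (S i ++ S j)) i [::]
     = setreg (setreg S1 j (S i ++ S j)) t [::]; last exact: H2.
    by rewrite /S1; regs_eq.
- by lia.
Qed.

(** Reading destroys a register, so the copy is made on the way back from [t], together with the
    restored original; the two reversals cancel. *)
Definition duplicate (i t j : nat) : cmd :=
  Then (transfer i t)
    (Loop t (Then (Push i false) (Push j false)) (Then (Push i true) (Push j true))).

Lemma cost_duplicate S i t j : i != t -> t != j -> i != j -> S t = [::] ->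
  cost (duplicate i t j) S (6 * size (S i) + 3) (setreg S j (S i ++ S j)).
Proof.
move=> Hit Htj Hij Ht.
have H1 := cost_transfer S Hit; rewrite Ht in H1.
set S1 := setreg _ i _ in H1.
move: (Hit) (Htj) (Hij) => /eqP Nit /eqP Ntj /eqP Nij.
have E1 : S1 t = rev (S i) by rewrite /S1 /setreg eq_sym (negbTE Hit) eqxx catrevE cats0.
have E2 : S1 j = S j by rewrite /S1 /setreg ![j == _]eq_sym (negbTE Htj) (negbTE Hij).
have E3 : S1 i = [::] by rewrite /S1 /setreg eqxx.
have main (s a c : seq bool) (S0 : regs) : S0 t = s -> S0 i = a -> S0 j = c ->
  cost (Loop t (Then (Push i false) (Push j false)) (Then (Push i true) (Push j true)))
    S0 (4 * size s + 1) (setreg (setreg (setreg S0 i (catrev s a)) j (catrev s c)) t [::]).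
  elim: s a c S0 => [|b s IHs] a c S0 F1 F2 F3.
    rewrite /= (setreg_id F2) (setreg_id F3) (setreg_id F1); exact: cost_Loop_nil.
  apply: (@cost_le _ _ (3 + (4 * size s + 1)).+1); last by rewrite /=; lia.
  apply: (cost_Loop_cons (S1 := setreg (setreg (setreg S0 t s) i (b :: a)) j (b :: c)) F1).
    have -> : (if b then Then (Push i true) (Push j true)
          else Then (Push i false) (Push j false)) = Then (Push i b) (Push j b) by case: (b).
    apply: (@cost_Then _ _ _ 1 _ 1); first exact: cost_Push.
    set S2 := setreg (setreg S0 t s) i _.
    have -> : S2 = setreg (setreg S0 t s) i (b :: a).
      by rewrite /S2 /setreg (negbTE Hit) F2.
    set S3 := setreg _ i _; have <- : S3 j = c; last exact: cost_Push.
    by rewrite /S3 /setreg ![j == _]eq_sym (negbTE Htj) (negbTE Hij).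
  set S1' := setreg _ j _.
  have := IHs (b :: a) (b :: c) S1'.
  have -> : setreg (setreg (setreg S1' i (catrev s (b :: a))) j (catrev s (b :: c))) t [::]
     = setreg (setreg (setreg S0 i (catrev (b :: s) a)) j (catrev (b :: s) c)) t [::].
    by rewrite /S1' /=; regs_eq.
  apply; rewrite /S1' /setreg ?eqxx ?(negbTE Htj) ?(negbTE Hij) //.
  by rewrite eq_sym (negbTE Hit).
apply: cost_le (cost_Then H1 _) _.
- have := main _ _ _ S1 E1 E3 E2; rewrite !catrevE revK cats0.
  have -> : setreg (setreg (setreg S1 i (S i)) j (S i ++ S j)) t [::] = setreg S j (S i ++ S j).
    by rewrite /S1; regs_eq.
  exact.
- by rewrite size_rev; lia.
Qed.

(** * Polynomial time functions and their closure properties *)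

Record context := Context { csort :> Type; cenc : csort -> seq (seq bool) }.

Definition csize (C : context) (c : C) : nat := sumn (map size (cenc c)).

Definition word_ctx : context := @Context (seq bool) (fun x => [:: x]).
Definition with_nat (C : context) : context :=
  @Context (C * nat)%type (fun p => rcons (cenc p.1) (nseq p.2 true)).

Definition computes (C : context) (f : C -> seq bool) (P : seq nat -> nat -> cmd)
    (p : nat -> nat) : Prop :=
  forall (c : C) (rho : seq nat) (d : nat) (S : regs),
    map S rho = cenc c -> all (fun i => i < d) rho -> (forall i, d <= i -> S i = [::]) ->
  cost (P rho d) S (p (csize c)) (setreg S d (f c)).

(* [P rho d] finds its arguments in the registers [rho], all below [d], and may use
   the registers from [d] on, which are initially empty. *)
Definition FP (C : context) (f : C -> seq bool) : Prop :=
  exists P p, poly p /\ computes f P p.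

(** Numbers are produced in unary, so membership already contains a polynomial bound on the value,
    and such a number can drive a loop. *)
Definition FN (C : context) (f : C -> nat) : Prop := FP (fun c => nseq (f c) true).
Definition FB (C : context) (f : C -> bool) : Prop := FN (fun c => nat_of_bool (f c)).

Lemma map_setreg (S : regs) rho d j s :
  all (fun i => i < d) rho -> d <= j -> map (setreg S j s) rho = map S rho.
Proof.
move=> /allP Hr Hj; apply/eq_in_map => i /Hr Hi.
by rewrite /setreg; case: eqP => // E; lia.
Qed.

Arguments map_setreg {S rho d j s}.

Lemma all_below (rho : seq nat) d e :
  all (fun i => i < d) rho -> d <= e -> all (fun i => i < e) rho.
Proof. by move=> H Hd; apply: sub_all H => i Hi; lia. Qed.

Lemma setreg_above (S : regs) d e j s : (forall i, d <= i -> S i = [::]) ->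
  d <= e -> j < e -> forall i, e <= i -> setreg S j s i = [::].
Proof. by move=> H Hd Hj i Hi; rewrite /setreg; case: eqP => [E|_]; [lia | apply: H; lia]. Qed.

Lemma setregE S i s : setreg S i s i = s.
Proof. by rewrite /setreg eqxx. Qed.

Lemma setregN S i s j : j != i -> setreg S i s j = S j.
Proof. by rewrite /setreg => /negbTE ->. Qed.

(** The result register starts empty and grows by at most one bit per unit of time, so the running
    time bounds the output. *)
Lemma FP_size (C : context) (f : C -> seq bool) : FP f ->
  exists2 q, poly q & forall c, size (f c) <= q (csize c).
Proof.
case=> P [p [Hp H]]; exists p => // c.
have [| |i Hi|n Hn E] := H c (iota 0 (size (cenc c))) (size (cenc c)) (nth [::] (cenc c)).
- by rewrite map_nth_iota0 // take_size.
- by apply/allP => i; rewrite mem_iota.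
- by rewrite nth_default.
have := exec_size (size (cenc c)) E; rewrite setregE nth_default //= add0n.
by move/leq_trans; apply.
Qed.

Section Closure.
Variable C : context.

Lemma FP_ext (f g : C -> seq bool) : f =1 g -> FP f -> FP g.
Proof. by move=> /functional_extensionality ->. Qed.

Lemma FN_ext (f g : C -> nat) : f =1 g -> FN f -> FN g.
Proof. by move=> /functional_extensionality ->. Qed.

Lemma csize_nat (c : C) i : csize (C := with_nat C) (c, i) = csize c + i.
Proof. by rewrite /csize /= map_rcons sumn_rcons size_nseq. Qed.

Lemma FP_const s : @FP C (fun _ => s).
Proof.
exists (fun _ d => foldr (fun b k => Then k (Push d b)) Skip s), (fun _ => (2 * size s).+1).
split; first exact: poly_const.
move=> c rho d S _ _ /(_ d (leqnn d)) Hd; elim: s => [|b s IHs] /=.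
  by rewrite setreg_id //; exact: cost_Skip.
apply: (@cost_le _ _ ((2 * size s).+1 + 1).+1); last by lia.
apply: cost_Then IHs _; set S1 := setreg _ _ _.
have -> : setreg S d (b :: s) = setreg S1 d (b :: S1 d).
  by rewrite /S1 setregE; regs_eq.
exact: cost_Push.
Qed.

Lemma FP_cat (f g : C -> seq bool) : FP f -> FP g -> FP (fun c => f c ++ g c).
Proof.
move=> Hf Hg; have [q Hq Hs] := FP_size Hf.
case: Hf Hg => [P [p [Hp Hf]]] [Q [p' [Hp' Hg]]].
(* The right word is computed first: a stack can be extended only at its front. *)
exists (fun rho d => Then (Q rho d) (Then (P rho d.+1) (prepend d.+1 d.+2 d))).
exists (fun n => p' n + (p n + (4 * q n + 5))); split.
  by do 3 apply: poly_add => //; [apply: poly_mul => // |]; exact: poly_const.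
move=> c rho d S Hrho Hall Hd.
have H1 := Hg c rho d S Hrho Hall Hd; set S1 := setreg _ _ _ in H1.
have H2 : cost (P rho d.+1) S1 (p (csize c)) (setreg S1 d.+1 (f c)).
  apply: Hf; [by rewrite (map_setreg Hall) | exact: all_below Hall _ |].
  exact: setreg_above Hd _ _.
set S2 := setreg S1 _ _ in H2.
have H3 : cost (prepend d.+1 d.+2 d) S2 (4 * size (S2 d.+1) + 3)
    (setreg (setreg S2 d (S2 d.+1 ++ S2 d)) d.+1 [::]).
  apply: cost_prepend; try lia.
  by rewrite /S2 /S1 !setregN; [apply: Hd | ..]; lia.
apply: cost_le (cost_Then H1 (cost_Then H2 _)) _.
- have -> : setreg S d (f c ++ g c) = setreg (setreg S2 d (S2 d.+1 ++ S2 d)) d.+1 [::].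
    rewrite {2 3}/S2 setregE setregN /S1 ?setregE; last by lia.
    by rewrite /S2 /S1; regs_eq; rewrite Hd //; lia.
  exact: H3.
- by rewrite /S2 setregE; have := Hs c; lia.
Qed.

Lemma FP_case (s e : C -> seq bool) (f g : C -> seq bool) :
    FP s -> FP e -> FP f -> FP g ->
  FP (fun c => match s c with [::] => e c | b :: _ => if b then g c else f c end).
Proof.
move=> Hs He Hf Hg; have [q Hq Hqs] := FP_size Hs.
case: Hs He Hf Hg => [Ps [ps [Hps Hs]]] [Pe [pe [Hpe He]]] [Pf [pf [Hpf Hf]]] [Pg [pg [Hpg Hg]]].
exists (fun rho d => Then (Ps rho d) (Case d (Pe rho d)
   (Then (clear d) (Pf rho d)) (Then (clear d) (Pg rho d)))).
exists (fun n => ps n + (pe n + (pf n + (pg n + (2 * q n + 5))))); split.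
  by do 5 apply: poly_add => //; [apply: poly_mul => // |]; exact: poly_const.
move=> c rho d S Hrho Hall Hd.
have H1 := Hs c rho d S Hrho Hall Hd; set S1 := setreg _ _ _ in H1.
have E1 : S1 d = s c by rewrite /S1 setregE.
have HSd : S d = [::] by exact: Hd.
case Ec: (s c) => [|b w].
  rewrite Ec in E1.
  have E : S1 = S by rewrite /S1 Ec setreg_id.
  apply: cost_le (cost_Then H1 (cost_Case_nil _ _ E1 _)) _.
    by rewrite E; apply: He.
  by lia.
rewrite Ec in E1.
have H3 := cost_clear (setreg S1 d w) d.
have E : setreg (setreg S1 d w) d [::] = S by rewrite /S1; regs_eq.
rewrite E setregE in H3.
have HC : cost (if b then Then (clear d) (Pg rho d) else Then (clear d) (Pf rho d))
    (setreg S1 d w) (2 * size w + 1 + (pf (csize c) + pg (csize c))).+1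
    (setreg S d (if b then g c else f c)).
  by case: (b); (apply: cost_le; first apply: cost_Then H3 _);
   [apply: Hg | lia | apply: Hf | lia].
apply: cost_le (cost_Then H1 (cost_Case_cons _ E1 HC)) _.
by have := Hqs c; rewrite Ec /=; lia.
Qed.

(* The counter register itself holds the loop variable in unary, so the iterations
   run downwards and each result is prepended to the accumulator. *)
Lemma FP_loop (n : C -> nat) (G : C -> nat -> seq bool) :
    FN n -> FP (C := with_nat C) (fun p => G p.1 p.2) ->
  FP (fun c => flatten [seq G c i | i <- iota 0 (n c)]).
Proof.
move=> Hn HG; have [q Hq Hqn] := FP_size Hn; have [g Hg Hgs] := FP_size HG.
case: Hn HG => [P [p [Hp Hn]]] [Q [p' [Hp' HG]]].
(* Register [d] is the counter and the last argument of the body, [d.+1] the accumulator, [d.+2] the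
   result of one round, [d.+3] scratch space. *)
pose body rho d := Then (Q (rcons rho d) d.+2) (prepend d.+2 d.+3 d.+1).
exists (fun rho d => Then (P rho d) (Then (Loop d Skip (body rho d)) (prepend d.+1 d.+2 d))).
exists (fun m => p m + (q m * (p' (m + q m) + (4 * g (m + q m) + 5)) +
   (4 * (q m * g (m + q m)) + 7))).
split.
  have Hnq : poly (fun n => n + q n) by apply: poly_add => //; exact: poly_id.
  have Hg' : poly (fun m => g (m + q m)) by exact: poly_comp Hnq.
  apply: poly_add => //; apply: poly_add.
    apply: poly_mul => //; apply: poly_add; first exact: poly_comp Hnq.
    by apply: poly_add; [apply: poly_mul => // |]; exact: poly_const.
  apply: poly_add; last exact: poly_const.
  by apply: poly_mul; [exact: poly_const | apply: poly_mul].
move=> c rho d S Hrho Hall Hd.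
have H1 := Hn c rho d S Hrho Hall Hd; set S1 := setreg _ _ _ in H1.
have {}Hqn : n c <= q (csize c) by have := Hqn c; rewrite size_nseq.
have Hgi i : i < n c -> size (G c i) <= g (csize c + q (csize c)).
  move=> Hi; have := Hgs (c, i); rewrite csize_nat /= => /leq_trans; apply.
  by case: Hg => Hg _; apply: Hg; lia.
have loop : forall k acc (S0 : regs), k <= n c -> S0 d = nseq k true -> S0 d.+1 = acc ->
    map S0 rho = cenc c -> (forall i, d.+2 <= i -> S0 i = [::]) ->
  cost (Loop d Skip (body rho d)) S0
    (k * (p' (csize c + q (csize c)) + (4 * g (csize c + q (csize c)) + 5)) + 1)
    (setreg (setreg S0 d [::]) d.+1 (flatten [seq G c i | i <- iota 0 k] ++ acc)).
  elim=> [|k IHk] acc S0 Hk F1 F2 F3 F4.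
    by rewrite /= (setreg_id F1) (setreg_id F2); exact: cost_Loop_nil.
  set S0' := setreg S0 d (nseq k true).
  have HQ : cost (Q (rcons rho d) d.+2) S0' (p' (csize (C := with_nat C) (c, k)))
     (setreg S0' d.+2 (G c k)).
    apply: (HG (c, k)).
    - by rewrite map_rcons /S0' (map_setreg Hall) // F3 setregE.
    - by rewrite all_rcons leqnSn; apply: all_below Hall _; lia.
    - by apply: (setreg_above (d := d.+2)) => //; lia.
  set S2 := setreg S0' _ _ in HQ.
  have HM : cost (prepend d.+2 d.+3 d.+1) S2 (4 * size (S2 d.+2) + 3)
    (setreg (setreg S2 d.+1 (S2 d.+2 ++ S2 d.+1)) d.+2 [::]).
    apply: cost_prepend; try lia.
    by rewrite /S2 /S0' !setregN; [apply: F4 | ..]; lia.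
  have E2 : S2 d.+2 = G c k by rewrite /S2 setregE.
  have E2' : S2 d.+1 = acc by rewrite /S2 /S0' !setregN //; lia.
  have {}HQ := cost_Then HQ HM.
  rewrite E2 E2' in HQ.
  set S3 := setreg _ d.+2 [::] in HQ.
  have HL : cost (Loop d Skip (body rho d)) S3
     (k * (p' (csize c + q (csize c)) + (4 * g (csize c + q (csize c)) + 5)) + 1)
     (setreg (setreg S3 d [::]) d.+1 (flatten [seq G c i | i <- iota 0 k] ++ (G c k ++ acc))).
    apply: IHk; first by lia.
    - by rewrite /S3 /S2 /S0' 3?setregN ?setregE //; lia.
    - by rewrite /S3 setregN ?setregE //; lia.
    - by rewrite /S3 /S2 /S0' !(map_setreg Hall) //; lia.
    - move=> i Hi; rewrite /S3 /S2 /S0'; have := F4 i Hi.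
      by rewrite /setreg; repeat case: eqP => ? //; lia.
  apply: cost_le (cost_Loop_cons F1 _ _) _.
  - exact: HQ.
  - rewrite -(addn1 k) iotaD add0n map_cat flatten_cat /= cats0 -catA.
    have -> : setreg (setreg S0 d [::]) d.+1
         (flatten [seq G c i | i <- iota 0 k] ++ (G c k ++ acc))
       = setreg (setreg S3 d [::]) d.+1 (flatten [seq G c i | i <- iota 0 k] ++ (G c k ++ acc)).
      have F5 := F4 d.+2 (leqnn _).
      by rewrite /S3 /S2 /S0'; regs_eq.
    exact: HL.
  - rewrite mulSn csize_nat; have := Hgi k Hk.
    have : p' (csize c + k) <= p' (csize c + q (csize c)).
      by case: Hp' => Hp' _; apply: Hp'; lia.
    by lia.
have H2 : cost (Loop d Skip (body rho d)) S1
    (n c * (p' (csize c + q (csize c)) + (4 * g (csize c + q (csize c)) + 5)) + 1)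
    (setreg (setreg S1 d [::]) d.+1 (flatten [seq G c i | i <- iota 0 (n c)] ++ [::])).
  apply: loop => //.
  - by rewrite /S1 setregE.
  - by rewrite /S1 setregN; [apply: Hd | ]; lia.
  - by rewrite /S1 (map_setreg Hall).
  - by apply: setreg_above Hd _ _; lia.
rewrite cats0 in H2; set out := flatten _ in H2 *.
set S2 := setreg _ d.+1 _ in H2.
have H3 : cost (prepend d.+1 d.+2 d) S2 (4 * size (S2 d.+1) + 3)
    (setreg (setreg S2 d (S2 d.+1 ++ S2 d)) d.+1 [::]).
  apply: cost_prepend; try lia.
  by rewrite /S2 /S1 !setregN; [apply: Hd | ..]; lia.
have E2 : S2 d.+1 = out by rewrite /S2 setregE.
have E2' : S2 d = [::] by rewrite /S2 setregN ?setregE //; lia.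
apply: cost_le (cost_Then H1 (cost_Then H2 _)) _.
- have -> : setreg S d out = setreg (setreg S2 d (S2 d.+1 ++ S2 d)) d.+1 [::].
    rewrite E2 E2' cats0 /S2 /S1.
    by regs_eq; rewrite Hd //; lia.
  exact: H3.
- rewrite E2.
  have Hout : size out <= n c * g (csize c + q (csize c)).
    rewrite /out size_flatten /shape -map_comp.
    have : forall m k, m + k <= n c -> sumn [seq (size \o G c) i | i <- iota m k]
        <= k * g (csize c + q (csize c)).
      move=> m k; elim: k m => //= k IHk m Hm.
      by rewrite mulSn; apply: leq_add; [apply: Hgi; lia | apply: IHk; lia].
    by apply.
  move: (p' _) (g _) Hout => A B Hout.
  have : n c * B <= q (csize c) * B by rewrite leq_mul2r Hqn orbT.
  have : n c * (A + (4 * B + 5)) <= q (csize c) * (A + (4 * B + 5)) by rewrite leq_mul2r Hqn orbT.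
  by lia.
Qed.

End Closure.

(** The additional argument comes last, so the program is run on all registers of [rho] but the last
    one. *)
Lemma FP_weaken (C C' : context) (pr : C' -> C) (v : C' -> seq bool) (f : C -> seq bool) :
    (forall p, cenc p = rcons (cenc (pr p)) (v p)) ->
  FP f -> FP (fun p => f (pr p)).
Proof.
move=> Henc [P [p [Hp H]]]; exists (fun rho d => P (take (size rho).-1 rho) d), p.
split=> // c rho d S Hrho Hall Hd.
have Hsz : (size rho).-1 = size (cenc (pr c)).
  by rewrite -(size_map S) Hrho Henc size_rcons.
apply: cost_le (H (pr c) (take (size rho).-1 rho) d S _ _ Hd) _.
- by rewrite map_take Hrho Henc Hsz -cats1 take_size_cat.
- by apply/allP => i /mem_take Hi; exact: (allP Hall).
- by case: Hp => Hp _; apply: Hp; rewrite /csize Henc map_rcons sumn_rcons leq_addr.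
Qed.

Lemma FP_last (C C' : context) (pr : C' -> C) (v : C' -> seq bool) :
    (forall p, cenc p = rcons (cenc (pr p)) (v p)) -> FP v.
Proof.
move=> Henc; exists (fun rho d => duplicate (last 0 rho) d.+1 d), (fun n => 6 * n + 3).
split.
  apply: poly_add; last exact: poly_const.
  by apply: poly_mul; [exact: poly_const | exact: poly_id].
move=> c rho d S Hrho Hall Hd.
have : map S rho = rcons (cenc (pr c)) (v c) by rewrite Hrho.
case/lastP: rho Hrho Hall => [|rho i] Hrho Hall; first by case: (cenc (pr c)).
rewrite map_rcons => /rcons_inj [_ Hi].
move: Hall; rewrite all_rcons last_rcons => /andP[Hid _].
have := @cost_duplicate S i d.+1 d; rewrite Hi (Hd d) // cats0 => H.
apply: cost_le (H _ _ _ _) _; rewrite ?Hd //; try lia.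
by rewrite /csize Henc map_rcons sumn_rcons; lia.
Qed.

Lemma FP_word : @FP word_ctx (fun x => x).
Proof.
exists (fun rho d => duplicate (last 0 rho) d.+1 d), (fun n => 6 * n + 3); split.
  apply: poly_add; last exact: poly_const.
  by apply: poly_mul; [exact: poly_const | exact: poly_id].
move=> c [|i [|]] d S //= [Hi] /andP[Hid _] Hd.
have := @cost_duplicate S i d.+1 d; rewrite Hi (Hd d) // cats0 => H.
apply: cost_le (H _ _ _ _) _; rewrite ?Hd //; try lia.
by rewrite /csize /=; lia.
Qed.

Lemma FP_fst_nat (C : context) (f : C -> seq bool) :
  FP f -> FP (C := with_nat C) (fun p => f p.1).
Proof. exact: (@FP_weaken C (with_nat C) fst (fun p => nseq p.2 true)). Qed.

Lemma FN_snd_nat (C : context) : FN (C := with_nat C) (fun p => p.2).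
Proof. exact: (@FP_last C (with_nat C) fst (fun p => nseq p.2 true)). Qed.

(** On unary numbers this is truncated subtraction, hence also comparison; followed by a case
    distinction it gives access to a single bit. *)
Lemma FP_drop (C : context) (n : C -> nat) (s : C -> seq bool) :
  FN n -> FP s -> FP (fun c => drop (n c) (s c)).
Proof.
move=> Hn Hs; have [q Hq Hqn] := FP_size Hn.
case: Hn Hs => [P [p [Hp Hn]]] [Q [p' [Hp' Hs]]].
exists (fun rho d => Then (Q rho d) (Then (P rho d.+1) (Loop d.+1 Skip (Case d Skip Skip Skip)))).
exists (fun m => p' m + (p m + (3 * q m + 3))); split.
  by do 3 apply: poly_add => //; [apply: poly_mul => // |]; exact: poly_const.
move=> c rho d S Hrho Hall Hd.
have H1 := Hs c rho d S Hrho Hall Hd; set S1 := setreg _ _ _ in H1.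
have H2 : cost (P rho d.+1) S1 (p (csize c)) (setreg S1 d.+1 (nseq (n c) true)).
  apply: Hn; [by rewrite /S1 (map_setreg Hall) | exact: all_below Hall _ |].
  exact: setreg_above Hd _ _.
have loop : forall k w (S0 : regs), S0 d = w -> S0 d.+1 = nseq k true ->
  cost (Loop d.+1 Skip (Case d Skip Skip Skip)) S0 (3 * k + 1)
    (setreg (setreg S0 d (drop k w)) d.+1 [::]).
  elim=> [|k IHk] w S0 F1 F2.
    by rewrite drop0 (setreg_id F1) (setreg_id F2); exact: cost_Loop_nil.
  set S0' := setreg S0 d.+1 (nseq k true).
  have F1' : S0' d = w by rewrite /S0' setregN //; lia.
  have HC : cost (Case d Skip Skip Skip) S0' 2 (setreg S0' d (behead w)).
    case: w F1 F1' => [|b w] F1 F1'.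
      by rewrite /= (setreg_id F1'); apply: (cost_Case_nil _ _ F1'); exact: cost_Skip.
    by apply: (cost_Case_cons _ F1'); case: (b); exact: cost_Skip.
  apply: cost_conv (cost_Loop_cons F2 HC (IHk (behead w) _ _ _)) _ _.
  - by rewrite setregE.
  - by rewrite /S0' setregN ?setregE //; lia.
  - by lia.
  have -> : drop k (behead w) = drop k.+1 w by rewrite -drop1 drop_drop addn1.
  by rewrite /S0'; regs_eq.
apply: cost_conv (cost_Then H1 (cost_Then H2 (loop (n c) (s c) _ _ _))) _ _.
- by rewrite setregN /S1 ?setregE //; lia.
- by rewrite setregE.
- by have := Hqn c; rewrite size_nseq; lia.
by rewrite /S1; regs_eq; rewrite Hd //; lia.
Qed.

Fixpoint pushes (w : seq bool) (j : nat) : cmd :=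
  if w is b :: w' then Then (Push j b) (pushes w' j) else Skip.

Lemma cost_pushes w j S : cost (pushes w j) S (2 * size w + 1) (setreg S j (catrev w (S j))).
Proof.
elim: w S => [|b w IHw] S /=; first by rewrite setreg_id //; exact: cost_Skip.
apply: cost_conv (cost_Then (cost_Push S j b) (IHw _)) _ _; first by lia.
by rewrite setregE; regs_eq.
Qed.

(** Two instances matter: both words [[:: true]] turn a word into its length in unary, and doubled
    bits give the body of [sdelim]. *)
Lemma FP_subst (C : context) (w0 w1 : seq bool) (s : C -> seq bool) :
  FP s -> FP (fun c => flatten [seq if b then w1 else w0 | b <- s c]).
Proof.
move=> Hs; have [q Hq Hqs] := FP_size Hs; case: Hs => [P [p [Hp Hs]]].
pose W := size w0 + size w1; pose g (b : bool) := if b then w1 else w0.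
exists (fun rho d => Then (P rho d)
  (Then (Loop d (pushes w0 d.+1) (pushes w1 d.+1)) (transfer d.+1 d))).
exists (fun m => p m + ((2 * W + 2) * q m + (2 * (W * q m) + 4))); split.
  apply: poly_add => //; apply: poly_add.
    by apply: poly_mul => //; exact: poly_const.
  apply: poly_add; last exact: poly_const.
  by apply: poly_mul; [exact: poly_const | apply: poly_mul => //; exact: poly_const].
move=> c rho d S Hrho Hall Hd.
have H1 := Hs c rho d S Hrho Hall Hd; set S1 := setreg _ _ _ in H1.
have loop : forall w acc (S0 : regs), S0 d = w -> S0 d.+1 = acc ->
  cost (Loop d (pushes w0 d.+1) (pushes w1 d.+1)) S0 ((2 * W + 2) * size w + 1)
    (setreg (setreg S0 d.+1 (catrev (flatten (map g w)) acc)) d [::]).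
  elim=> [|b w IHw] acc S0 F1 F2.
    by rewrite muln0 /= (setreg_id F2) (setreg_id F1); exact: cost_Loop_nil.
  set S0' := setreg S0 d w.
  have F2' : S0' d.+1 = acc by rewrite /S0' setregN //; lia.
  have HC : cost (if b then pushes w1 d.+1 else pushes w0 d.+1) S0' (2 * W + 1)
      (setreg S0' d.+1 (catrev (g b) acc)).
    rewrite -F2'; apply: (@cost_le _ _ (2 * size (g b) + 1)).
      by rewrite /g; case: (b); exact: cost_pushes.
    by rewrite /W /g; case: (b); lia.
  apply: cost_conv (cost_Loop_cons F1 HC (IHw (catrev (g b) acc) _ _ _)) _ _.
  - by rewrite /S0' setregN ?setregE //; lia.
  - by rewrite setregE.
  - by rewrite /= mulnS; lia.
  by rewrite /= !catrevE rev_cat -catA /S0'; regs_eq.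
have H2 := loop (s c) [::] S1 _ _.
have {}H2 : cost (Loop d (pushes w0 d.+1) (pushes w1 d.+1)) S1 ((2 * W + 2) * size (s c) + 1)
    (setreg (setreg S1 d.+1 (catrev (flatten (map g (s c))) [::])) d [::]).
  apply: H2; first by rewrite /S1 setregE.
  by rewrite /S1 setregN; [apply: Hd|]; lia.
set S2 := setreg _ d [::] in H2.
have E2 : S2 d.+1 = rev (flatten (map g (s c))).
  by rewrite /S2 setregN ?setregE ?catrevE ?cats0 //; lia.
have E2' : S2 d = [::] by rewrite /S2 setregE.
have Nd : d.+1 != d by lia.
have H3 := cost_transfer S2 Nd.
rewrite E2 E2' catrevE revK cats0 size_rev in H3.
apply: cost_le (cost_Then H1 (cost_Then H2 _)) _.
- have -> : setreg S d (flatten (map g (s c)))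
     = setreg (setreg S2 d (flatten (map g (s c)))) d.+1 [::].
    by rewrite /S2 /S1; regs_eq; rewrite Hd //; lia.
  exact: H3.
- have : size (flatten (map g (s c))) <= W * size (s c).
    elim: (s c) => [|b w IHw] //=; rewrite size_cat mulnS; apply: leq_add => //.
    by rewrite /g /W; case: (b); lia.
  have : W * size (s c) <= W * q (csize c) by rewrite leq_mul2l Hqs orbT.
  have : (2 * W + 2) * size (s c) <= (2 * W + 2) * q (csize c) by rewrite leq_mul2l Hqs orbT.
  by lia.
Qed.

Lemma nat_bits_aux_fuel f g n : n <= f -> n <= g -> nat_bits_aux f n = nat_bits_aux g n.
Proof.
elim: f g n => [|f IHf] [|g] [|n] //= Hf Hg; congr cons.
by apply: IHf; rewrite uphalf_half; have := odd_double_half n; lia.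
Qed.

Lemma nat_bitsE n : nat_bits n = if n == 0 then [::] else odd n :: nat_bits n./2.
Proof.
case: n => // n; rewrite [in LHS]/nat_bits; rewrite [nat_bits_aux _ _]/=; congr cons.
apply: nat_bits_aux_fuel => //; have := odd_double_half n.+1; lia.
Qed.

(** Repeated halving of a unary number: register [d.+2] collects the quotient, [d.+3] the parity,
    and [d.+1] the bits. The lowest bit gets to the bottom, so the final transfer puts it in
    front. *)
Lemma FP_bits (C : context) (n : C -> nat) : FN n -> FP (fun c => nat_bits (n c)).
Proof.
move=> Hn; have [q Hq Hqn] := FP_size Hn; case: Hn => [P [p [Hp Hn]]].
pose halve d := Loop d Skip (Case d (Push d.+3 true) Skip (Push d.+2 true)).
(* The push restores the unit that the enclosing [Loop] has consumed by its test. *)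
pose body d := Then (Push d true) (Then (halve d)
  (Then (Case d.+3 (Push d.+1 false) Skip (Push d.+1 true)) (transfer d.+2 d))).
exists (fun rho d => Then (P rho d) (Then (Loop d Skip (body d)) (transfer d.+1 d))).
exists (fun m => p m + (q m * (6 * q m + 20) + (2 * q m + 4))); split.
  apply: poly_add => //; apply: poly_add.
    apply: poly_mul => //; apply: poly_add; last exact: poly_const.
    by apply: poly_mul => //; exact: poly_const.
  apply: poly_add; last exact: poly_const.
  by apply: poly_mul => //; exact: poly_const.
move=> c rho d S Hrho Hall Hd.
have H1 := Hn c rho d S Hrho Hall Hd; set S1 := setreg _ _ _ in H1.
have Hhalve : forall m k (S0 : regs), S0 d = nseq m true -> S0 d.+2 = nseq k true ->
    S0 d.+3 = [::] ->
  cost (halve d) S0 (3 * m + 1)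
    (setreg (setreg (setreg S0 d [::]) d.+2 (nseq (m./2 + k) true)) d.+3 (nseq (odd m) true)).
  move=> m; have [l] := ubnP m; elim: l m => // l IHl [|[|m]] Hm k S0 F1 F2 F3.
  - rewrite /= (setreg_id F1) (setreg_id F2) (setreg_id F3); exact: cost_Loop_nil.
  - set S0' := setreg S0 d [::].
    have F1' : S0' d = [::] by rewrite /S0' setregE.
    have HC := cost_Case_nil Skip (Push d.+2 true) F1' (cost_Push S0' d.+3 true).
    apply: cost_conv (cost_Loop_cons F1 HC (cost_Loop_nil _ _ _)) _ _.
    + by rewrite setregN //; lia.
    + by [].
    rewrite {2}/S0' setregN ?F3; last by lia.
    by rewrite /S0' /= add0n; regs_eq.
  - set S0' := setreg S0 d (nseq m.+1 true).
    have F1' : S0' d = true :: nseq m true by rewrite /S0' setregE.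
    have HC := cost_Case_cons (Push d.+3 true) F1' (cf := Skip) (cost_Push _ d.+2 true).
    set S2 := setreg _ _ _ in HC.
    have E2 : S2 d = nseq m true by rewrite /S2 /S0' setregN ?setregE //; lia.
    have E2' : S2 d.+2 = nseq k.+1 true.
      by rewrite /S2 /S0' setregE !setregN ?F2 //; lia.
    have E2'' : S2 d.+3 = [::] by rewrite /S2 /S0' !setregN ?F3 //; lia.
    apply: cost_conv (cost_Loop_cons F1 HC (IHl m _ k.+1 S2 E2 E2' E2'')) _ _; try lia.
    have -> : m.+2./2 + k = m./2 + k.+1 by rewrite /=; lia.
    have -> : odd m.+2 = odd m by rewrite /= negbK.
    by rewrite /S2 /S0'; regs_eq.
have Hloop : forall m acc (S0 : regs), S0 d = nseq m true -> S0 d.+1 = acc ->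
    S0 d.+2 = [::] -> S0 d.+3 = [::] ->
  cost (Loop d Skip (body d)) S0 (m * (6 * m + 20) + 1)
    (setreg (setreg S0 d [::]) d.+1 (catrev (nat_bits m) acc)).
  move=> m; have [l] := ubnP m; elim: l m => // l IHl [|m] Hm acc S0 F1 F2 F3 F4.
    rewrite /= (setreg_id F1) (setreg_id F2); exact: cost_Loop_nil.
  set S2 := setreg S0 d (nseq m true).
  have HA := cost_Push S2 d true; have F1' : S0 d = true :: nseq m true by [].
  have {HA} : cost (Push d true) S2 1 S0.
    by move: HA; rewrite /S2 setregE; match goal with |- cost _ _ _ ?A -> _ =>
      have -> // : A = S0 by regs_eq end.
  move=> HA; have HB := Hhalve m.+1 0 S0 F1 F3 F4; rewrite addn0 in HB.
  set S3 := setreg _ d.+3 _ in HB.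
  have HC : cost (Case d.+3 (Push d.+1 false) Skip (Push d.+1 true)) S3 2
      (setreg (setreg S3 d.+3 [::]) d.+1 (odd m.+1 :: acc)).
    have E3 : S3 d.+3 = nseq (odd m.+1) true by rewrite /S3 setregE.
    have E3' : S3 d.+1 = acc by rewrite /S3 !setregN ?F2 //; lia.
    move: E3; case: (odd m.+1) => E3.
      apply: (cost_Case_cons _ E3).
      by rewrite -E3' -(setregN S3 [::] (i := d.+3) (j := d.+1)); [exact: cost_Push | lia].
    apply: (cost_Case_nil _ _ E3).
    by rewrite (setreg_id E3) -E3'; exact: cost_Push.
  set S4 := setreg _ d.+1 _ in HC.
  have Nd : d.+2 != d by lia.
  have HD := cost_transfer S4 Nd.
  have E4 : S4 d.+2 = nseq m.+1./2 true.
    by rewrite /S4 /S3 3?setregN ?setregE //; lia.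
  have E4' : S4 d = [::] by rewrite /S4 /S3 4?setregN ?setregE //; lia.
  rewrite E4 E4' catrevE cats0 rev_nseq size_nseq in HD.
  have HE := cost_Then HA (cost_Then HB (cost_Then HC HD)).
  set S5 := setreg _ d.+2 [::] in HE.
  have Hhalf : m.+1./2 <= m by have := odd_double_half m.+1; lia.
  have HL : cost (Loop d Skip (body d)) S5 (m.+1./2 * (6 * m.+1./2 + 20) + 1)
     (setreg (setreg S5 d [::]) d.+1 (catrev (nat_bits m.+1./2) (odd m.+1 :: acc))).
    apply: IHl; first by lia.
    - by rewrite /S5 setregN ?setregE //; lia.
    - by rewrite /S5 2?setregN /S4 ?setregE //; lia.
    - by rewrite /S5 setregE.
    - by rewrite /S5 2?setregN /S4 1?setregN ?setregE //; lia.
  apply: cost_le (cost_Loop_cons F1 HE _) _.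
  - have -> : setreg (setreg S0 d [::]) d.+1 (catrev (nat_bits m.+1) acc)
      = setreg (setreg S5 d [::]) d.+1 (catrev (nat_bits m.+1./2) (odd m.+1 :: acc)).
      have -> : catrev (nat_bits m.+1) acc = catrev (nat_bits m.+1./2) (odd m.+1 :: acc).
        by rewrite (nat_bitsE m.+1).
      by rewrite /S5 /S4 /S3; regs_eq.
    exact: HL.
  - have : m.+1./2 * (6 * m.+1./2 + 20) <= m * (6 * m.+1 + 20) by apply: leq_mul; lia.
    by rewrite [m.+1 * _]mulSn; lia.
have H2 : cost (Loop d Skip (body d)) S1 (n c * (6 * n c + 20) + 1)
    (setreg (setreg S1 d [::]) d.+1 (catrev (nat_bits (n c)) [::])).
  apply: Hloop; rewrite /S1 ?setregE // setregN; try (by apply: Hd; lia); lia.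
set S2 := setreg _ d.+1 _ in H2.
have E2 : S2 d.+1 = rev (nat_bits (n c)) by rewrite /S2 setregE catrevE cats0.
have E2' : S2 d = [::] by rewrite /S2 setregN ?setregE //; lia.
have Nd : d.+1 != d by lia.
have H3 := cost_transfer S2 Nd.
rewrite E2 E2' catrevE revK cats0 size_rev in H3.
apply: cost_le (cost_Then H1 (cost_Then H2 _)) _.
- have -> : setreg S d (nat_bits (n c)) = setreg (setreg S2 d (nat_bits (n c))) d.+1 [::].
    by rewrite /S2 /S1; regs_eq; rewrite Hd //; lia.
  exact: H3.
- have Hb : forall m, size (nat_bits m) <= m.
    move=> m; have [l] := ubnP m; elim: l m => // l IHl [|m] Hm //.
    rewrite nat_bitsE /= ltnS; have H : m.+1./2 <= m by have := odd_double_half m.+1; lia.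
    by apply: leq_trans H; apply: IHl; have := odd_double_half m.+1; lia.
  have := Hqn c; rewrite size_nseq => Hqc; have := Hb (n c).
  have : n c * (6 * n c + 20) <= q (csize c) * (6 * q (csize c) + 20) by apply: leq_mul; lia.
  by lia.
Qed.

(** * Unary arithmetic, tests and encoders *)

Section Arithmetic.
Variable C : context.
Implicit Types (n m : C -> nat) (s f g : C -> seq bool) (b : C -> bool).

Lemma FN_const k : @FN C (fun _ => k).
Proof. exact: FP_const. Qed.

Lemma FN_add n m : FN n -> FN m -> FN (fun c => n c + m c).
Proof.
move=> Hn Hm; apply: FP_ext (FP_cat Hn Hm) => c /=.
by rewrite nseqD.
Qed.

Lemma FN_sub n m : FN n -> FN m -> FN (fun c => n c - m c).
Proof.
move=> Hn Hm; apply: FP_ext (FP_drop Hm Hn) => c /=.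
by rewrite drop_nseq.
Qed.

Lemma FN_mul n m : FN n -> FN m -> FN (fun c => n c * m c).
Proof.
move=> Hn Hm; apply: FP_ext (FP_loop Hn (G := fun c _ => nseq (m c) true) _).
  move=> c /=; elim: (n c) {Hn Hm} 0 => //= k IHk i.
  by rewrite IHk mulSn nseqD.
exact: (FP_fst_nat Hm).
Qed.

Lemma FN_exp n k : FN n -> FN (fun c => n c ^ k).
Proof.
move=> Hn; elim: k => [|k IHk]; first exact: FN_const.
by apply: FN_ext (FN_mul Hn IHk) => c /=; rewrite expnS.
Qed.

Lemma FN_size s : FP s -> FN (fun c => size (s c)).
Proof.
move=> Hs; apply: FP_ext (FP_subst [:: true] [:: true] Hs) => c /=.
by elim: (s c) => //= b w ->; case: b.
Qed.

Lemma FP_if b f g : FB b -> FP f -> FP g -> FP (fun c => if b c then f c else g c).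
Proof.
by move=> Hb Hf Hg; apply: FP_ext (FP_case Hb Hg Hg Hf) => c /=; case: (b c).
Qed.

Lemma FN_if b n m : FB b -> FN n -> FN m -> FN (fun c => if b c then n c else m c).
Proof.
by move=> Hb Hn Hm; apply: FP_ext (FP_if Hb Hn Hm) => c /=; case: (b c).
Qed.

Lemma FB_nth s n : FP s -> FN n -> FB (fun c => nth false (s c) (n c)).
Proof.
move=> Hs Hn.
apply: FP_ext (FP_case (FP_drop Hn Hs) (FP_const _ [::]) (FP_const _ [::])
  (FP_const _ [:: true])) => c /=.
by rewrite -{2}[n c]addn0 -nth_drop; case: (drop _ _) => [|[]].
Qed.

Lemma FB_eq n m : FN n -> FN m -> FB (fun c => n c == m c).
Proof.
move=> Hn Hm.
apply: FP_ext (FP_case (FN_add (FN_sub Hn Hm) (FN_sub Hm Hn)) (FP_const _ [:: true])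
  (FP_const _ [::]) (FP_const _ [::])) => c /=.
rewrite eqn_leq -!subn_eq0 -addn_eq0.
by case: (n c - m c + (m c - n c)).
Qed.

(** A list that does not depend on the input is unrolled into the program. This treats the
    enumerations of cell contents, which depend on the verifier only. *)
Lemma FP_flatten_const (T : Type) (l : seq T) (G : T -> C -> seq bool) :
  (forall a, FP (G a)) -> FP (fun c => flatten [seq G a c | a <- l]).
Proof.
move=> HG; elim: l => [|a l IHl] /=; first exact: FP_const.
exact: FP_cat.
Qed.

Lemma FP_sdelim s : FP s -> FP (fun c => sdelim (s c)).
Proof.
move=> Hs; apply: FP_cat (FP_const _ _); apply: FP_ext (FP_subst _ _ Hs) => c.
by congr flatten; apply: eq_map; case.
Qed.

Lemma FP_enc_nat n : FN n -> FP (fun c => enc_nat (n c)).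
Proof. by move=> Hn; apply/FP_sdelim/FP_bits. Qed.

End Arithmetic.

Lemma FP_machine (f : seq bool -> seq bool) : @FP word_ctx f ->
  exists (F : TM) (c k : nat), forall x,
    halts_within F (pbound c k (size x)) x /\ output F (pbound c k (size x)) x = f x.
Proof.
case=> P [p [Hp Hf]].
(* The tape shows register 0 from its bottom, so the input is stored there reversed; the first
   transfer straightens it, the last one reverses the result for output. *)
pose c := Then (transfer 0 1) (Then (P [:: 1] 2) (transfer 2 0)).
pose r := (max_reg c).+1.
(* A machine starts at cell 0 while compiled code starts at cell -1; the last move returns to cell
   0, where the output begins. *)
pose M := fseq (atom id MoveL) (fseq (compile r c) (atom id MoveR)).
pose N m := 2 * m + 1 + (p m + (2 * p m + 1)).+1.+1.
pose tm m := 2 * N m * op_time r (m + N m) + 2.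
have HN : poly N.
  have H : N =1 fun m => 2 * m + (3 * p m + 4) by move=> m; rewrite /N; lia.
  rewrite (functional_extensionality _ _ H).
  apply: poly_add; first by apply: poly_mul; [exact: poly_const | exact: poly_id].
  by apply: poly_add; [apply: poly_mul => // |]; exact: poly_const.
have Htm : poly tm.
  apply: poly_add; last exact: poly_const.
  apply: poly_mul; first by apply: poly_mul => //; exact: poly_const.
  apply: poly_mul; first exact: poly_const.
  apply: poly_add; last exact: poly_const.
  by apply: poly_add => //; exact: poly_id.
have [a [k Hak]] := poly_pbound Htm.
exists (TM_of_fragment M), a, k => x.
pose S0 : regs := setreg (fun _ => [::]) 0 (rev x).
have E0 : tape_of_word x = tape_of r S0.
  apply: functional_extensionality => -[z|z] /=; first by rewrite revK.
  by case: ifP => // _; rewrite onth0n.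
have [t Ht Hrun] : exists2 t, t <= tm (size x) & exists S1 : regs, S1 0 = rev (f x) /\
    runs M t 0%R (tape_of_word x) 0%R (tape_of r S1).
  have H1 := @cost_transfer S0 0 1 isT.
  set S1 := setreg _ 0 _ in H1.
  have F1 : S1 = setreg (fun _ => [::]) 1 x.
    rewrite /S1 /S0 setregE setregN // catrevE revK cats0; regs_eq.
  have ES0 : S0 0 = rev x by [].
  rewrite ES0 size_rev in H1.
  have H2 : cost (P [:: 1] 2) S1 (p (size x)) (setreg S1 2 (f x)).
    have -> : size x = @csize word_ctx x by rewrite /csize /= addn0.
    apply: Hf => //; first by rewrite F1 /= setregE.
    by move=> [|[|i]].
  set S2 := setreg S1 _ _ in H2.
  have H3 := @cost_transfer S2 2 0 isT; set S3 := setreg _ 2 _ in H3.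
  have E3 : S3 0 = rev (f x).
    by rewrite /S3 setregN // setregE {1}/S2 setregE catrevE /S2 setregN // F1 cats0.
  have Hfx : size (S2 2) <= p (size x).
    case: H2 => n Hn /(exec_size 2).
    rewrite F1 /= add0n => /leq_trans; apply; exact: Hn.
  have [n Hn Hex] : cost c S0 (N (size x)) S3.
    by apply: cost_le (cost_Then H1 (cost_Then H2 H3)) _; rewrite /N; lia.
  have Hsz i : size (S0 i) + n <= size x + N (size x).
    by apply: leq_add => //; rewrite /S0 /setreg; case: eqP; rewrite ?size_rev.
  have r_gt0 : 0 < r by [].
  have [[t Ht H] _] := runs_compile r_gt0 Hex (leqnSn _) Hsz.
  exists (1 + (t + 1)).
    rewrite /tm; have : 2 * n * op_time r (size x + N (size x)) <=
      2 * N (size x) * op_time r (size x + N (size x)) by rewrite leq_mul2r leq_mul2l Hn !orbT.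
    by lia.
  exists S3; split=> //.
  have HL := runs_atom id MoveL 0%R (tape_of_word x); rewrite tupd_id in HL.
  have HR := runs_atom id MoveR (Negz 0) (tape_of r S3); rewrite tupd_id in HR.
  rewrite E0 in HL *.
  exact: runs_fseq HL (runs_fseq H HR).
case: Hrun => S1 [E1 Hrun].
have Hlast := arun_fragment Hrun (leq_trans Ht (Hak _)).
split; first by rewrite /halts_within cstate_arun Hlast.
apply: (output_arun Hlast) => i /=.
by rewrite E1 revK.
Qed.

(** * Tableaux *)

Section Cells.
Variable M : TM.

Definition cell := (sym * option (tm_state M))%type.
Definition blank : cell := (None, None).

Definition content (ac : aconf M) (p : int) : cell :=
  let: (q, h, t) := ac in (t p, if p == h then Some q else None).

(** The state that a cell hands over in direction [mv], if it carries the head. Comparing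
    displacements serves as the equality test on moves. *)
Definition sent (mv : move) (a : cell) : option (tm_state M) :=
  if a.2 is Some q then
    if shift (eff_delta q a.1).2 == shift mv then Some (eff_delta q a.1).1.1 else None
  else None.

(** On triples with several heads the order of the tests is an arbitrary choice. Such triples do not
    occur in a run, so the clauses that mention them constrain nothing that is used. *)
Definition local_rule (a b c : cell) : cell :=
  (if b.2 is Some q then (eff_delta q b.1).1.2 else b.1,
   if sent Stay b is Some q then Some q
   else if sent MoveR a is Some q then Some q else sent MoveL c).

Lemma content_step ac p :
  content (astep ac) p = local_rule (content ac (p - 1)) (content ac p) (content ac (p + 1)).
Proof.
case: ac => [[q h] t]; rewrite /astep /content /local_rule /sent /=.
case Ed: (eff_delta q (t h)) => [[q' w] mv]; congr pair.
  by rewrite /tupd; case: eqP => [->|//]; rewrite Ed.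
case: (p =P h) => [->|Hp].
  have -> : (h - 1 == h)%R = false by lia.
  have -> : (h + 1 == h)%R = false by lia.
  by rewrite Ed /=; case: mv Ed => _ /=; case: eqP => //; lia.
case: (p =P h + shift mv)%R => Hm.
- case: mv Ed Hm => /= Ed Hm.
  + have -> : (p - 1 == h)%R = false by lia.
    have E : (p + 1 = h)%R by lia.
    by rewrite E eqxx Ed.
  + have E : (p - 1 = h)%R by lia.
    by rewrite E eqxx Ed.
  + by case: Hp; rewrite Hm addr0.
- case: eqP => E1; first rewrite E1 Ed /=.
    case: eqP => E2; first by exfalso; apply: Hm; rewrite E2; lia.
    by have -> : (p + 1 == h)%R = false by lia.
  case: eqP => E3 //; rewrite E3 Ed /=.
  by case: eqP => // E4; exfalso; apply: Hm; rewrite E4; lia.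
Qed.

Lemma arunS n z : arun M n.+1 z = astep (arun M n z).
Proof. by []. Qed.

(** Head and written cells spread by at most one position per step. A nonempty [z] makes the initial
    head position 0 belong to the word. *)
Lemma content_blank n z p : 0 < size z ->
    (p < - n%:Z)%R \/ ((size z + n)%:Z <= p)%R ->
  content (arun M n z) p = blank.
Proof.
move=> Hz; elim: n p => [|n IHn] p Hp.
  rewrite /content /=; case: eqP => [E|_]; first by exfalso; lia.
  by case: p Hp => //= p Hp; rewrite onth_default //; lia.
by rewrite arunS content_step !IHn //; lia.
Qed.

Lemma head_bound n z : let: (_, h, _) := arun M n z in (- n%:Z <= h <= n%:Z)%R.
Proof.
elim: n => [|n]; first by [].
rewrite arunS; case: (arun M n z) => [[q h] t] Hh /=.
by case: (eff_delta q (t h)) => [[q' w] mv]; case: mv => /=; lia.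
Qed.

End Cells.

Section Tableau.
Variables (M : TM) (w : seq bool) (q T : nat).
Hypothesis w_gt0 : 0 < size w.

(** By row [T] the left edge has drifted [T] cells to the right while the head may have gone [T]
    cells to the left; 4 is slack for windows across two rows. No such margin is needed on the
    right, since the drift keeps pace with the head. *)
Definition offset : nat := 2 * T + 4.
Definition width : nat := offset + (size w + q).

Definition rejecting (g : cell M) : bool :=
  if g.2 is Some st then ~~ tm_accept M st else false.

(* Row [t] of the tableau consists of the cells [t * width + j] with [j < width]
   and shows position [t + j - offset].  The rows drift to the right by one cell
   per step, so that every cell [J + width] depends on [J], [J + 1] and [J + 2];
   where this window straddles two rows, all the cells involved are blank. *)
Record satisfies (s : nat -> cell M -> bool) : Prop := Satisfies {
  sat_left : forall J, J < offset -> s J (blank M);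
  sat_word : forall i, i < size w ->
    s (offset + i) (Some (nth false w i), if i == 0 then Some (tm_start M) else None);
  sat_free : forall i, i < q ->
    [|| s (offset + size w + i) (blank M),
        s (offset + size w + i) (Some false, None) |
        s (offset + size w + i) (Some true, None)];
  sat_pad : forall i, i.+1 < q ->
    s (offset + size w + i) (blank M) -> s (offset + size w + i.+1) (blank M);
  sat_step : forall J a b c, J < T * width -> s J a -> s J.+1 b -> s J.+2 c ->
    s (J + width) (local_rule a b c);
  sat_accept : forall j g, j < width -> rejecting g -> ~~ s (T * width + j) g
}.

Definition tableau (z : seq bool) (J : nat) : cell M :=
  content (arun M (J %/ width) z) ((J %% width)%:Z + (J %/ width)%:Z - offset%:Z)%R.

Lemma width_gt2 : 2 < width.
Proof. by rewrite /width /offset; lia. Qed.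

Lemma tableauE z n j : j < width ->
  tableau z (n * width + j) = content (arun M n z) (j%:Z + n%:Z - offset%:Z)%R.
Proof.
have := width_gt2 => Hw Hj; rewrite /tableau divnMDl ?modnMDl; last by lia.
by rewrite divn_small // modn_small // addn0.
Qed.

Lemma tableau_row0 z j : j < width -> tableau z j = content (arun M 0 z) (j%:Z - offset%:Z)%R.
Proof. by move=> Hj; have := tableauE z 0 Hj; rewrite mul0n add0n addr0. Qed.

Lemma tableau_step z J : size w <= size z <= size w + q -> J < T * width ->
  tableau z (J + width) = local_rule (tableau z J) (tableau z J.+1) (tableau z J.+2).
Proof.
move=> /andP[Hz1 Hz2] HJ; have Hw := width_gt2.
have Hz : 0 < size z by lia.
have HW : width = 2 * T + 4 + (size w + q) by [].
have Ht : J %/ width < T by rewrite ltn_divLR //; lia.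
have Hj : J %% width < width by rewrite ltn_mod; lia.
rewrite (divn_eq J width); move: (J %/ width) (J %% width) Ht Hj => t j Ht Hj {HJ}.
have -> : t * width + j + width = t.+1 * width + j by rewrite mulSn; lia.
rewrite -!addnS (tableauE z t.+1 Hj) (tableauE z t Hj) arunS content_step.
(* The cells just beyond the end of row [t] are numbered as the first cells of row [t.+1]. The
   former would lie right of everything written, the latter lie left of it, so both readings give a
   blank. *)
have over i : i <= 1 ->
  tableau z (t * width + (width + i)) = content (arun M t z) ((width + i)%:Z + t%:Z - offset%:Z)%R.
  move=> Hi; have -> : t * width + (width + i) = t.+1 * width + i by rewrite mulSn; lia.
  rewrite tableauE; last by lia.
  by rewrite !content_blank //; [right | left]; rewrite /offset; lia.
have next i : i <= width.+1 ->
  tableau z (t * width + i) = content (arun M t z) (i%:Z + t%:Z - offset%:Z)%R.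
  move=> Hi; have [Hi'|Hi'] := ltnP i width; first exact: tableauE.
  by have := over (i - width); rewrite subnKC // => -> //; lia.
rewrite (next j.+1) ?(next j.+2); try lia.
by congr local_rule; congr content; lia.
Qed.

Lemma satisfies_tableau u : size u <= q ->
    tm_accept M (astate (arun M T (w ++ u))) ->
  satisfies (fun J g => tableau (w ++ u) J == g).
Proof.
move=> Hu Hacc.
have Hz : size w <= size (w ++ u) <= size w + q by rewrite size_cat; lia.
have Hz0 : 0 < size (w ++ u) by lia.
(* Beyond the end of [u] the value [onth u i] is [None], which is the blank used for padding. *)
have cert i : i < q -> tableau (w ++ u) (offset + size w + i) = (onth u i, None).
  move=> Hi; rewrite tableau_row0; last by rewrite /width; lia.
  rewrite /content /=; case: eqP => [E|_]; first by exfalso; lia.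
  have -> : ((offset + size w + i)%:Z - offset%:Z)%R = Posz (size w + i) by lia.
  by rewrite /= onth_cat ltnNge leq_addr /= addKn.
split.
- move=> J HJ; rewrite tableau_row0; last by rewrite /width; lia.
  by apply/eqP; rewrite content_blank //; left; lia.
- move=> i Hi; rewrite tableau_row0; last by rewrite /width; lia.
  have -> : ((offset + i)%:Z - offset%:Z)%R = Posz i by lia.
  by rewrite /content /= onth_cat Hi onthE (nth_map false) //; case: i Hi.
- move=> i Hi; rewrite cert //; case: (onth u i) => [[]|]; by rewrite ?eqxx ?orbT.
- move=> i Hi; rewrite !cert; [|lia..].
  by move=> /eqP[]; rewrite /blank; case E: (onth u i) => // _;
     rewrite onth_default //; apply: leqW; rewrite -onthNE E.
- by move=> J a b c HJ /eqP <- /eqP <- /eqP <-; rewrite tableau_step.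
- move=> j g Hj Hg; rewrite tableauE //; apply/eqP => E; move: Hg Hacc.
  rewrite -E /rejecting; case: (arun M T (w ++ u)) => [[st h] t] /=.
  by case: eqP => // _ /negP.
Qed.

Lemma satisfies_accept s : satisfies s ->
  exists2 u, size u <= q & tm_accept M (astate (arun M T (w ++ u))).
Proof.
move=> Hs; pose p i := s (offset + size w + i) (blank M).
(* The certificate is cut at the first cell that [s] allows to be blank, or at [q]. From there on
   [sat_pad] yields blanks; before it [sat_free] leaves at least one bit, and [true] is
   preferred. *)
pose k := find p (iota 0 q); have Hk : k <= q by have := find_size p (iota 0 q); rewrite size_iota.
pose u := mkseq (fun i => s (offset + size w + i) (Some true, None)) k.
have Hu : size u = k by rewrite size_mkseq.
exists u; first by rewrite Hu.
have Hz : size w <= size (w ++ u) <= size w + q by rewrite size_cat Hu; lia.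
have Hz0 : 0 < size (w ++ u) by lia.
have before i : i < k -> ~~ p i.
  by move=> Hi; have := before_find 0 Hi; rewrite nth_iota ?add0n => [->|]; last lia.
have after i : k <= i -> i < q -> p i.
  elim: i => [|i IHi] Hi Hiq.
    have Hkq : has p (iota 0 q) by rewrite has_find size_iota -/k; lia.
    have E : k = 0 by lia.
    by have := nth_find 0 Hkq; rewrite -/k E nth_iota.
  have [Hki|Hki] := ltnP i k.
    have E : k = i.+1 by lia.
    have Hkq : has p (iota 0 q) by rewrite has_find size_iota -/k E.
    by have := nth_find 0 Hkq; rewrite -/k E nth_iota.
  by apply: (sat_pad Hs) => //; apply: IHi => //; lia.
have row0 J : J < width -> s J (tableau (w ++ u) J).
  move=> HJ; rewrite tableau_row0 //.
  have [H1|H1] := ltnP J offset.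
    by rewrite content_blank //; [exact: (sat_left Hs) | left; lia].
  have [i Ei] : exists i, J = offset + i by exists (J - offset); lia.
  have -> : (J%:Z - offset%:Z)%R = Posz i by lia.
  rewrite /content /=.
  have [H2|H2] := ltnP i (size w).
    by have := sat_word Hs H2; rewrite -Ei onth_cat H2 onthE (nth_map false) //.
  have [l El] : exists l, i = size w + l by exists (i - size w); lia.
  have Hl : l < q by move: HJ; rewrite /width; lia.
  rewrite onth_cat ltnNge H2 /= El addKn.
  have -> : (Posz (size w + l) == 0%R) = false by lia.
  rewrite Ei El addnA.
  have [H3|H3] := ltnP l k.
    have := sat_free Hs Hl; rewrite -/(p l) (negbTE (before l H3)) /=.
    rewrite onthE (nth_map false) ?Hu // nth_mkseq //.
    by case E: (s _ (Some true, None)) => //; rewrite orbF.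
  by rewrite onth_default ?Hu //; exact: after.
(* Strong induction on the cell number, across row boundaries: since [width] exceeds 2, all three
   predecessors have smaller numbers. *)
have all J : J < T.+1 * width -> s J (tableau (w ++ u) J).
  have [n] := ubnP J; elim: n J => // n IHn J HJn HJ.
  have [H1|H1] := ltnP J width; first exact: row0.
  have Hw := width_gt2.
  have HJ' : J - width < T * width by move: HJ; rewrite mulSn; lia.
  have EJ : J = J - width + width by lia.
  rewrite {2}EJ tableau_step // {1}EJ.
  by apply: (sat_step Hs) => //; apply: IHn; lia.
move: (head_bound M T (w ++ u)); case E: (arun M T (w ++ u)) => [[st h] t] Hh /=.
(* By the choice of [offset] the final head position lies inside row [T], so the cell carrying the
   final state is covered by [sat_accept]. *)
have [j Hj] : exists j : nat, (h - T%:Z + offset%:Z)%R = Posz j.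
  exists (absz (h - T%:Z + offset%:Z)%R); rewrite /offset; lia.
have HjW : j < width by rewrite /width; lia.
have := all (T * width + j); rewrite tableauE // E /content.
have -> : (j%:Z + T%:Z - offset%:Z)%R = h by lia.
rewrite eqxx; case Hst : (tm_accept M st) => //.
have Hr : rejecting (t h, Some st) by rewrite /rejecting /= Hst.
have := sat_accept Hs HjW Hr.
by move=> /negbTE ->; rewrite mulSn => H; apply: H; lia.
Qed.

End Tableau.

(** * Training a ReLU against integer constraints *)

Section ReluRows.
Local Open Scope ring_scope.

(** If [b <= 0], the third term is 1, and [w + b] and [- w + b] are not both positive, so one of the
    first two terms is 1 as well; a total of 2 makes the remaining term vanish. If [b > 0], the
    total exceeds 2. *)
Lemma relu_gadget (F : realFieldType) (w b : F) :
  let g := (Num.max 0 (w + b) - 1) ^+ 2 + (Num.max 0 (- w + b) - 1) ^+ 2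
           + (Num.max 0 b + 1) ^+ 2 in
  2 <= g /\ (g <= 2 -> b <= 0 /\ (w = 1 - b \/ w = - (1 - b))).
Proof.
rewrite /=.
have [Q1 Q2] := (sqr_ge0 (w + b - 1), sqr_ge0 (- w + b - 1)).
have [Q3 Q4] := (sqr_ge0 b, sqr_ge0 w).
(* For the case where all three ReLUs are active: the first two terms sum to at least
   [2 * (b - 1) ^+ 2], and adding [(b + 1) ^+ 2] gives [(3 * b - 1) ^+ 2 / 3 + 8 / 3]. *)
have Q5 := sqr_ge0 (3 * b - 1).
have zero (x : F) : x ^+ 2 <= 0 -> x = 0.
  move=> H; apply/eqP; rewrite -sqrf_eq0; apply/eqP; have := sqr_ge0 x; lra.
case: (leP 0 b) => Hb; case: (leP 0 (w + b)) => H1; case: (leP 0 (- w + b)) => H2.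
all: split; [rewrite ?expr2 in Q1 Q2 Q3 Q4 Q5 *; try lra|].
all: try (move=> H; split; [rewrite ?expr2 in Q1 Q2 Q3 Q4 Q5 H; try lra|]).
all: try (exfalso; rewrite ?expr2 in Q1 Q2 Q3 Q4 Q5 H; lra).
all: try (left; have : w + b - 1 = 0 by apply: zero; rewrite ?expr2 in Q1 Q2 Q3 Q4 Q5 H *; lra).
all: try lra.
all: try (right; have : - w + b - 1 = 0 by apply: zero; rewrite ?expr2 in Q1 Q2 Q3 Q4 Q5 H *; lra).
all: try lra.
Qed.

(* A row of a training instance: an integer label and a sparse integer vector, of
   which the first entry with a given index counts. *)
Definition row : Type := int * seq (nat * int).

Fixpoint coef (l : seq (nat * int)) (j : nat) : int :=
  if l is (k, a) :: l' then if j == k then a else coef l' j else 0.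

Definition row_matrix (rs : seq row) (N : nat) : 'M[rat]_(size rs, N) :=
  \matrix_(i, j) (coef (nth (0, [::]) rs i).2 j)%:~R.

Definition row_labels (rs : seq row) : 'cV[rat]_(size rs) :=
  \col_i ((nth (0, [::]) rs i).1)%:~R.

Definition gadget_rows (v : nat) : seq row :=
  [:: (1, [:: (v, 1)]); (1, [:: (v, -1)]); (-1, [::])].

Definition training_rows (N : nat) (cs : seq (seq (nat * int))) : seq row :=
  flatten [seq gadget_rows v | v <- iota 0 N] ++ [seq (0, l) | l <- cs].

Definition sign_value (s : nat -> bool) (v : nat) : int := if s v then 1 else -1.

Definition holds (N : nat) (s : nat -> bool) (l : seq (nat * int)) : bool :=
  \sum_(j < N) coef l j * sign_value s j <= 0.

Definition row_error (N : nat) (w : nat -> R) (b : R) (r : row) : R :=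
  (Num.max 0 (\sum_(j < N) (coef r.2 j)%:~R * w j + b) - (r.1)%:~R) ^+ 2.

Lemma relu_error_rows rs N (w : 'cV[R]_N) (w' : nat -> R) b :
    (forall j : 'I_N, w j ord0 = w' j) ->
  relu_error (row_matrix rs N) (row_labels rs) true w b = \sum_(r <- rs) row_error N w' b r.
Proof.
move=> Hw; rewrite (big_nth (0, [::])) big_mkord; apply: eq_bigr => i _.
rewrite /row_error /relu /sgn_coef mul1r mxE ratr_int; congr ((Num.max 0 (_ + _) - _) ^+ 2).
by apply: eq_bigr => j _; rewrite mxE ratr_int Hw.
Qed.

Lemma sum_coef1 (N v : nat) (a : int) (w : nat -> R) : (v < N)%N ->
  \sum_(j < N) (coef [:: (v, a)] j)%:~R * w j = a%:~R * w v.
Proof.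
move=> Hv; rewrite (bigD1 (Ordinal Hv)) //= eqxx big1 ?addr0 // => j Hj.
case: eqP => [E|_]; last by rewrite mul0r.
by case/eqP: Hj; apply: val_inj.
Qed.

Lemma training_error N cs w b :
  \sum_(r <- training_rows N cs) row_error N w b r =
    \sum_(v < N) ((Num.max 0 (w v + b) - 1) ^+ 2 + (Num.max 0 (- w v + b) - 1) ^+ 2
                  + (Num.max 0 b + 1) ^+ 2)
    + \sum_(l <- cs) (Num.max 0 (\sum_(j < N) (coef l j)%:~R * w j + b)) ^+ 2.
Proof.
rewrite /training_rows big_cat big_map big_flatten big_map /=; congr (_ + _).
  have -> : iota 0 N = index_iota 0 N by rewrite /index_iota subn0.
  rewrite big_mkord.
  apply: eq_bigr => v _; rewrite !big_cons big_nil addr0 /row_error /= addrA.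
  rewrite !sum_coef1 // big1 => [|j _]; last by rewrite mul0r.
  by rewrite !mul1r mulN1r add0r opprK.
by apply: eq_bigr => l _; rewrite /row_error /= subr0.
Qed.

Lemma holds_real N s l (c : R) :
  \sum_(j < N) (coef l j)%:~R * (c * (sign_value s j)%:~R)
  = c * (\sum_(j < N) coef l j * sign_value s j)%:~R.
Proof.
rewrite (rmorph_sum (intmul (1 : R))) mulr_sumr; apply: eq_bigr => j _ /=.
by rewrite intrM mulrCA.
Qed.

Lemma relu_yes_rows N cs : (0 < N)%N ->
  relu_yes (row_matrix (training_rows N cs) N) (row_labels (training_rows N cs)) true (2 * N)%:R
  <-> exists s : nat -> bool, all (holds N s) cs.
Proof.
move=> HN; split=> [[w [b]]|[s Hs]].
  pose w' j := if insub j is Some i then w i ord0 else 0.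
  rewrite (@relu_error_rows _ _ _ w'); last by move=> j; rewrite /w' valK.
  rewrite training_error ratr_nat => Herr.
  pose g (v : nat) : R := (Num.max 0 (w' v + b) - 1) ^+ 2
    + (Num.max 0 (- w' v + b) - 1) ^+ 2 + (Num.max 0 b + 1) ^+ 2.
  pose h l : R := (Num.max 0 (\sum_(j < N) (coef l j)%:~R * w' j + b)) ^+ 2.
  have {}Herr : \sum_(v < N) g v + \sum_(l <- cs) h l <= (2 * N)%:R := Herr.
  have Hg v : 2 <= g v by case: (relu_gadget (w' v) b).
  have Hh l : 0 <= h l by exact: sqr_ge0.
  have Hgs : 2 * N%:R <= \sum_(v < N) g v.
    have -> : 2 * N%:R = \sum_(v < N) (2 : R).
      by rewrite sumr_const card_ord mulr_natr.
    by apply: ler_sum.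
  have Hhs : 0 <= \sum_(l <- cs) h l by apply: sumr_ge0.
  rewrite natrM in Herr.
  have Hg2 v : (v < N)%N -> g v <= 2.
    move=> Hv; have : \sum_(v < N) (g v - 2) <= 0.
      rewrite sumrB sumr_const card_ord -mulr_natr; lra.
    rewrite (bigD1 (Ordinal Hv)) //=.
    have : 0 <= \sum_(i < N | i != Ordinal Hv) (g i - 2).
      by apply: sumr_ge0 => i _; have := Hg i; lra.
    by lra.
  (* All gadgets share the bias, and one of them suffices for [b <= 0]. Then [1 - b] is positive, so
     a weight shows its sign. *)
  have [_ /(_ (Hg2 0%N HN))[Hb _]] := relu_gadget (w' 0%N) b.
  exists (fun v => 0 < w' v).
  have Hw v : (v < N)%N -> w' v = (1 - b) * (sign_value (fun v => 0 < w' v) v)%:~R.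
    move=> Hv; rewrite /sign_value /=; have [_ /(_ (Hg2 v Hv))[_ [->|->]]] := relu_gadget (w' v) b.
      have -> : 0 < 1 - b by lra.
      by rewrite mulr1z mulr1.
    have -> : (0 < - (1 - b)) = false by lra.
    by rewrite mulrN1z mulrN1.
  apply/allP => l Hl.
  have Hl0 : h l <= 0.
    have := Herr; rewrite (big_rem l Hl) /=.
    have : 0 <= \sum_(y <- rem l cs) h y by apply: sumr_ge0.
    by lra.
  rewrite /holds leNgt; apply/negP => Hpos.
  move: Hl0; rewrite /h.
  rewrite (eq_bigr (fun j : 'I_N => (coef l j)%:~R *
     ((1 - b) * (sign_value (fun v => 0 < w' v) j)%:~R))); last by move=> j _; rewrite -Hw.
  rewrite holds_real; move: (\sum_(j < N) _) Hpos => z Hz.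
  have Hz1 : (1 : R) <= z%:~R by rewrite ler1z; lia.
  have Hp : 0 < (1 - b) * z%:~R + b by nra.
  rewrite max_r; last exact: ltW.
  by rewrite leNgt exprn_gt0.
(* With zero bias and unit weights each gadget costs exactly 2, and each constraint sample is on the
   inactive side of the ReLU. *)
exists (\col_j (sign_value s j)%:~R), 0.
rewrite (@relu_error_rows _ _ _ (fun j => 1 * (sign_value s j)%:~R)); last first.
  by move=> j; rewrite mxE mul1r.
rewrite training_error ratr_nat [X in _ + X]big_seq [X in _ + X]big1 => [|l Hl]; last first.
  rewrite holds_real mul1r addr0 max_l ?expr0n //.
  by rewrite lerz0; move/allP: Hs => /(_ _ Hl).
rewrite addr0 (eq_bigr (fun _ => 2)) => [|v _].
  by rewrite sumr_const card_ord natrM mulr_natr.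
rewrite mul1r /sign_value; case: (s v); rewrite !addr0 /Num.max.
  have -> : (0 < 1 :> R) by exact: ltr01.
  have -> : (0 < -1 :> R) = false by lra.
  by rewrite ltxx; lra.
have -> : (0 < -1 :> R) = false by lra.
have -> : (0 < - -1 :> R) by lra.
by rewrite ltxx; lra.
Qed.

End ReluRows.

(** * Encodings *)

(** [RELU_TRAIN] asks for some yes-instance with the given encoding, so soundness of the reduction
    needs the encoding to determine the instance. The remainders [r] and [r'] let the property pass
    through concatenated fields. *)
Definition prefix_code (T : Type) (E : T -> seq bool) : Prop :=
  forall a b r r', E a ++ r = E b ++ r' -> a = b /\ r = r'.

(** Bits come in equal pairs, and the terminator is the first unequal pair. *)
Lemma sdelim_prefix_code : prefix_code sdelim.
Proof.
rewrite /sdelim; elim=> [|x a IHa] [|y b] r r' /=.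
- by case.
- by case: y.
- by case: x.
- by case=> -> _ /IHa[-> ->].
Qed.

Lemma nat_bits_inj : injective nat_bits.
Proof.
move=> m; have [k] := ubnP m; elim: k m => // k IHk m Hm n.
rewrite nat_bitsE (nat_bitsE n); case: (m =P 0) => [->|Hm0]; case: (n =P 0) => [->|Hn0] //.
case=> Ho Hb; have E : m./2 = n./2 by apply: IHk Hb; have := odd_double_half m; lia.
by rewrite -(odd_double_half m) -(odd_double_half n) Ho E.
Qed.

Lemma enc_nat_prefix_code : prefix_code enc_nat.
Proof. by move=> a b r r' /sdelim_prefix_code[/nat_bits_inj]. Qed.

Lemma enc_int_prefix_code : prefix_code enc_int.
Proof.
move=> a b r r' [Hs] /enc_nat_prefix_code[Ha ->]; split=> //.
by case: a b Hs Ha => [a|a] [b|b] //= _; lia.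
Qed.

Lemma enc_rat_prefix_code : prefix_code enc_rat.
Proof.
move=> a b r r'; rewrite /enc_rat -(catA (enc_int (numq a))) -(catA (enc_int (numq b))).
move=> /enc_int_prefix_code[Hn] /enc_nat_prefix_code[Hd ->].
split=> //; rewrite -(divq_num_den a) -(divq_num_den b) Hn.
have := denq_gt0 a; have := denq_gt0 b => Hb Ha.
by have -> : denq a = denq b by lia.
Qed.

Lemma flatten_prefix_code (I : eqType) (T : Type) (E : T -> seq bool) (s : seq I) f g r r' :
    prefix_code E ->
  flatten [seq E (f i) | i <- s] ++ r = flatten [seq E (g i) | i <- s] ++ r' ->
  {in s, f =1 g} /\ r = r'.
Proof.
move=> HE; elim: s => [|i s IHs] //=; rewrite -!catA => /HE[Hi] /IHs[Hs ->]; split=> //.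
by move=> j; rewrite inE => /orP[/eqP ->|/Hs].
Qed.

(** An implication, since the matrices of the two instances have different types until the decoded
    dimensions have been identified. *)
Lemma enc_instance_yes m n (X : 'M[rat]_(m, n)) y a t m' n' (X' : 'M[rat]_(m', n')) y' a' t' :
  enc_instance X y a t = enc_instance X' y' a' t' ->
  relu_yes X y a t -> relu_yes X' y' a' t'.
Proof.
rewrite /enc_instance => /enc_nat_prefix_code[Em] /enc_nat_prefix_code[En]; subst m' n'.
rewrite -(map_allpairs (fun p => enc_rat (X p.1 p.2)) pair).
rewrite -(map_allpairs (fun p => enc_rat (X' p.1 p.2)) pair).
move=> /(flatten_prefix_code (f := fun p => X p.1 p.2) (g := fun p => X' p.1 p.2)
  enc_rat_prefix_code)[HX].
move=> /(flatten_prefix_code (f := fun i => y i ord0) (g := fun i => y' i ord0)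
  enc_rat_prefix_code)[Hy] Hat.
have <- : a = a' := congr1 (head true) Hat.
have H : enc_rat t = enc_rat t' := congr1 behead Hat.
have [<- _] : t = t' /\ [::] = [::] :> seq bool.
  by apply: (enc_rat_prefix_code (r := [::]) (r' := [::])); rewrite !cats0.
have -> : X = X'.
  by apply/matrixP => i j; apply: (HX (i, j)); apply/allpairsP; exists (i, j); rewrite !mem_enum.
have -> // : y = y'.
by apply/colP => i; apply: Hy; rewrite mem_enum.
Qed.

Lemma flatten_flatten (T : Type) (sss : seq (seq (seq T))) :
  flatten (flatten sss) = flatten (map flatten sss).
Proof. by elim: sss => //= ss sss IH; rewrite flatten_cat IH. Qed.

Lemma map_enum_ord (T : Type) (n : nat) (f : nat -> T) :
  [seq f (val i) | i <- enum 'I_n] = [seq f i | i <- iota 0 n].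
Proof. by rewrite (map_comp f val) val_enum_ord. Qed.

Lemma map_nth_enum (T S : Type) (x : T) (rs : seq T) (F : T -> S) :
  [seq F (nth x rs (val i)) | i <- enum 'I_(size rs)] = [seq F r | r <- rs].
Proof.
by rewrite (map_enum_ord (size rs) (fun i => F (nth x rs i))) map_comp map_nth_iota0 // take_size.
Qed.

Definition enc_coef (z : int) : seq bool := enc_int z ++ enc_nat 1.

Lemma enc_rat_int (z : int) : enc_rat z%:~R = enc_coef z.
Proof. by rewrite /enc_rat numq_int denq_int. Qed.

Definition enc_rows (rs : seq row) (N : nat) : seq bool :=
  enc_nat (size rs) ++ enc_nat N
  ++ flatten [seq flatten [seq enc_coef (coef r.2 j) | j <- iota 0 N] | r <- rs]
  ++ flatten [seq enc_coef r.1 | r <- rs]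
  ++ [:: true] ++ (false :: enc_nat (2 * N)) ++ enc_nat 1.

Lemma enc_instance_rows (rs : seq row) (N : nat) :
  enc_instance (row_matrix rs N) (row_labels rs) true (2 * N)%:R = enc_rows rs N.
Proof.
rewrite /enc_instance /enc_rows; do 2 congr cat; congr cat; last congr cat.
- rewrite flatten_flatten -(map_comp flatten).
  rewrite -(map_nth_enum (0%R, [::]) rs (fun r => flatten [seq enc_coef (coef r.2 j) | j <- iota 0 N])).
  congr flatten; apply: eq_map => i /=; congr flatten.
  by rewrite -map_enum_ord; apply: eq_map => j /=; rewrite mxE enc_rat_int.
- rewrite -(map_nth_enum (0%R, [::]) rs (fun r => enc_coef r.1)).
  by congr flatten; apply: eq_map => i; rewrite mxE enc_rat_int.
- congr cat; rewrite pmulrn enc_rat_int.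
  by [].
Qed.

Lemma RELU_TRAIN_rows N cs : 0 < N ->
  RELU_TRAIN (enc_rows (training_rows N cs) N) <-> exists s, all (holds N s) cs.
Proof.
move=> HN; rewrite -relu_yes_rows //; split=> [[m [n [X [y [a [t [_ E Hyes]]]]]]]|Hyes].
  by move: E; rewrite -enc_instance_rows => /esym/enc_instance_yes; apply.
do 6 eexists; split; [|symmetry; exact: enc_instance_rows | exact: Hyes].
exact: ler0n.
Qed.

(** * The reduction *)

(** Lists of rows or constraints are never data of a program; only their concatenated image under an
    encoder is computed. The encoder depends on the input because a row is written with [N]
    entries. *)
Definition emits (C : context) (A : Type) (E : C -> A -> seq bool) (R : C -> seq A) : Prop :=
  FP (fun c => flatten [seq E c r | r <- R c]).

Lemma emits_one (C : context) (A : Type) (E : C -> A -> seq bool) (r : C -> A) :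
  FP (fun c => E c (r c)) -> emits E (fun c => [:: r c]).
Proof. by move=> H; apply: FP_ext H => c /=; rewrite cats0. Qed.

Lemma emits_cat (C : context) (A : Type) (E : C -> A -> seq bool) (R1 R2 : C -> seq A) :
  emits E R1 -> emits E R2 -> emits E (fun c => R1 c ++ R2 c).
Proof.
by move=> H1 H2; apply: FP_ext (FP_cat H1 H2) => c /=; rewrite map_cat flatten_cat.
Qed.

Lemma emits_const (C : context) (A B : Type) (E : C -> A -> seq bool) (l : seq B)
    (R : B -> C -> seq A) :
  (forall b, emits E (R b)) -> emits E (fun c => flatten [seq R b c | b <- l]).
Proof.
move=> H; apply: FP_ext (FP_flatten_const l H) => c /=.
by rewrite map_flatten flatten_flatten -!map_comp.
Qed.

Lemma emits_loop (C : context) (A : Type) (E : C -> A -> seq bool) (n : C -> nat)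
    (R : C -> nat -> seq A) :
    FN n -> emits (C := with_nat C) (fun p => E p.1) (fun p => R p.1 p.2) ->
  emits E (fun c => flatten [seq R c i | i <- iota 0 (n c)]).
Proof.
move=> Hn H.
apply: FP_ext (FP_loop Hn (G := fun c i => flatten [seq E c r | r <- R c i]) H) => c /=.
by rewrite map_flatten flatten_flatten -!map_comp.
Qed.

(** * Families of constraints that can be written out in polynomial time *)

Definition constraint : Type := seq (nat * int).

Definition enc_constraint (N : nat) (l : constraint) : seq bool :=
  flatten [seq enc_coef (coef l j) | j <- iota 0 N].

(** The number of entries and the coefficients are fixed while the indices are computed, so that
    looking up an entry is a fixed nest of equality tests. *)
Inductive sparse (C : context) : (C -> constraint) -> Prop :=
| sparse_nil : sparse (fun _ => [::])
| sparse_cons k a l : FN k -> sparse l -> sparse (fun c => (k c, a) :: l c).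

Lemma FP_enc_constraint (C : context) (N : C -> nat) (l : C -> constraint) :
  FN N -> sparse l -> FP (fun c => enc_constraint (N c) (l c)).
Proof.
move=> HN Hl; apply: (FP_loop HN (G := fun c j => enc_coef (coef (l c) j))).
elim: Hl => [|k a {}l Hk _ IHl] /=; first exact: FP_const.
have H := FP_if (FB_eq (FN_snd_nat C) (FP_fst_nat Hk)) (FP_const _ (enc_coef a)) IHl.
by apply: FP_ext H => p; case: eqP.
Qed.

(** The second emission counts the constraints in unary; the number of samples has to be written in
    front of the samples. *)
Definition family (C : context) (N : C -> nat) (cs : C -> seq constraint) : Prop :=
  emits (fun c => enc_constraint (N c)) cs /\ emits (fun _ _ => [:: true]) cs.

Lemma family_one (C : context) (N : C -> nat) (l : C -> constraint) :
  FN N -> sparse l -> family N (fun c => [:: l c]).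
Proof.
by move=> HN Hl; split; apply: emits_one; [exact: FP_enc_constraint | exact: FP_const].
Qed.

Lemma family_cat (C : context) (N : C -> nat) (cs1 cs2 : C -> seq constraint) :
  family N cs1 -> family N cs2 -> family N (fun c => cs1 c ++ cs2 c).
Proof. by move=> [H1 H2] [H3 H4]; split; apply: emits_cat. Qed.

Lemma family_const (C : context) (B : Type) (N : C -> nat) (l : seq B)
    (cs : B -> C -> seq constraint) :
  (forall b, family N (cs b)) -> family N (fun c => flatten [seq cs b c | b <- l]).
Proof. by move=> H; split; apply: emits_const => b; case: (H b). Qed.

Lemma family_loop (C : context) (N n : C -> nat) (cs : C -> nat -> seq constraint) :
    FN n -> family (C := with_nat C) (fun p => N p.1) (fun p => cs p.1 p.2) ->
  family N (fun c => flatten [seq cs c i | i <- iota 0 (n c)]).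
Proof. by move=> Hn [H1 H2]; split; apply: emits_loop. Qed.

Lemma flatten_nseq1 (T : Type) (s : seq T) : flatten [seq [:: true] | _ <- s] = nseq (size s) true.
Proof. by elim: s => //= _ s ->. Qed.

Lemma size_training_rows N cs : size (training_rows N cs) = 3 * N + size cs.
Proof.
rewrite /training_rows size_cat size_map; congr addn.
rewrite -[in RHS](size_iota 0 N); elim: (iota 0 N) => //= v l ->; lia.
Qed.

Lemma flatten_gadget_rows (E : row -> seq bool) (l : seq nat) :
  flatten [seq E r | r <- flatten [seq gadget_rows v | v <- l]]
  = flatten [seq E (1%R, [:: (v, 1%R)]) ++ (E (1%R, [:: (v, (-1)%R)]) ++ E ((-1)%R, [::]))
            | v <- l].
Proof. by elim: l => //= v l ->; rewrite -!catA. Qed.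

Lemma FP_training_rows (C : context) (N : C -> nat) (cs : C -> seq constraint) :
  FN N -> family N cs -> FP (fun c => enc_rows (training_rows (N c) (cs c)) (N c)).
Proof.
move=> HN [Hc Hs].
have {}Hs : FN (fun c => size (cs c)).
  by apply: FP_ext Hs => c; rewrite flatten_nseq1.
have HN' := FP_fst_nat HN.
have Hone a : FP (C := with_nat C) (fun p => enc_constraint (N p.1) [:: (p.2, a)]).
  apply: (FP_enc_constraint HN') => //; apply: sparse_cons (FN_snd_nat C) _.
  exact: sparse_nil.
have Hnil : FP (C := with_nat C) (fun p => enc_constraint (N p.1) [::]).
  by apply: (FP_enc_constraint HN'); exact: sparse_nil.
have H1 : FP (fun c => enc_nat (size (training_rows (N c) (cs c)))).
  apply: FP_ext (FP_enc_nat (FN_add (FN_mul (FN_const C 3) HN) Hs)) => c.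
  by rewrite size_training_rows.
have H2 : FP (fun c => flatten [seq flatten [seq enc_coef (coef r.2 j) | j <- iota 0 (N c)]
                               | r <- training_rows (N c) (cs c)]).
  apply: FP_ext (FP_cat (FP_loop HN (G := fun c v => enc_constraint (N c) [:: (v, 1%R)] ++
    (enc_constraint (N c) [:: (v, (-1)%R)] ++ enc_constraint (N c) [::])) _) Hc).
    by move=> c; rewrite /training_rows map_cat flatten_cat flatten_gadget_rows -map_comp.
  by apply: FP_cat => //; apply: FP_cat.
have H3 : FP (fun c => flatten [seq enc_coef r.1 | r <- training_rows (N c) (cs c)]).
  apply: FP_ext (FP_cat (FP_loop HN (G := fun _ _ => enc_coef 1 ++ enc_coef 1 ++ enc_coef (-1)) _)
    (FP_loop Hs (G := fun _ _ => enc_coef 0) _)); [|exact: FP_const..].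
  move=> c; rewrite /training_rows map_cat flatten_cat flatten_gadget_rows -map_comp.
  congr (_ ++ flatten _).
  apply: (@eq_from_nth _ [::]); rewrite ?size_map ?size_iota // => i Hi.
  by rewrite !(nth_map 0) ?size_iota // (nth_map [::]).
apply: FP_cat H1 _; apply: FP_cat (FP_enc_nat HN) _; apply: FP_cat H2 _.
apply: FP_cat H3 _; apply: FP_cat (FP_const _ _) _.
apply: FP_cat (FP_const _ [:: false]) _; apply: FP_cat _ (FP_const _ _).
exact: FP_enc_nat (FN_mul (FN_const C 2) HN).
Qed.

(** * Clauses as inequalities between signs *)

Section Constraints.
Local Open Scope ring_scope.
Variables (N : nat) (s : nat -> bool).

(** Distinct indices are required because [coef] sees only the first entry with a given index,
    whereas the sum over [l] sees all of them. *)
Lemma holdsE (l : constraint) :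
    uniq [seq p.1 | p <- l] -> all (fun p => (p.1 < N)%N) l ->
  holds N s l = (\sum_(p <- l) p.2 * sign_value s p.1 <= 0).
Proof.
move=> Hu Ha; rewrite /holds; congr (_ <= _).
elim: l Hu Ha => [|[k a] l IHl] /=.
  by move=> _ _; rewrite big_nil big1 // => j _; rewrite mul0r.
move=> /andP[Hk Hu] /andP[HkN Ha]; rewrite big_cons -(IHl Hu Ha) /=.
rewrite (bigD1 (Ordinal HkN)) //= eqxx; congr (_ + _).
rewrite [RHS](bigD1 (Ordinal HkN)) //=.
have -> : coef l k = 0.
  elim: l Hk {IHl Hu Ha} => //= -[k' a'] l IHl; rewrite inE negb_or => /andP[/negbTE -> /IHl].
  exact.
rewrite mul0r add0r; apply: eq_bigr => j Hj; case: eqP => // E.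
by case/eqP: Hj; apply: val_inj.
Qed.

Lemma holds_true k : (k < N)%N -> holds N s [:: (k, -1)] = s k.
Proof.
by move=> Hk; rewrite holdsE //= ?Hk // big_seq1 /= /sign_value; case: (s k).
Qed.

Lemma holds_false k : (k < N)%N -> holds N s [:: (k, 1)] = ~~ s k.
Proof.
by move=> Hk; rewrite holdsE //= ?Hk // big_seq1 /= /sign_value; case: (s k).
Qed.

Lemma holds_implies k l : k != l -> (k < N)%N -> (l < N)%N ->
  holds N s [:: (k, 1); (l, -1)] = (s k ==> s l).
Proof.
move=> Hkl Hk Hl; rewrite holdsE /= ?inE ?Hkl ?Hk ?Hl // !big_cons big_nil /= /sign_value.
by case: (s k); case: (s l).
Qed.

(** If the three variables are false the sum is 3 - 1 = 2; making one of them true lowers it by 2,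
    just to 0. *)
Lemma holds_or3 k l m z : uniq [:: k; l; m; z] -> all (fun i => (i < N)%N) [:: k; l; m; z] ->
    s z ->
  holds N s [:: (k, -1); (l, -1); (m, -1); (z, -1)] = [|| s k, s l | s m].
Proof.
move=> Hu Ha Hz; rewrite holdsE // !big_cons big_nil /= /sign_value Hz.
by case: (s k); case: (s l); case: (s m).
Qed.

(** The only violation, true premises with a false conclusion, has sum 3 + 1 - 2 = 2; changing any
    of the four values lowers the sum by 2. This fixes the coefficient -2 of the constant. *)
Lemma holds_horn3 k l m d z : uniq [:: k; l; m; d; z] ->
    all (fun i => (i < N)%N) [:: k; l; m; d; z] -> s z ->
  holds N s [:: (k, 1); (l, 1); (m, 1); (d, -1); (z, -2)] = [&& s k, s l & s m] ==> s d.
Proof.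
move=> Hu Ha Hz; rewrite holdsE // !big_cons big_nil /= /sign_value Hz.
by case: (s k); case: (s l); case: (s m); case: (s d).
Qed.

End Constraints.

(** * The tableau as a list of constraints *)

Section Tableau_constraints.
Variables (M : TM) (w : seq bool) (q T : nat).
Hypothesis w_gt0 : 0 < size w.

Notation W := (width w q T).
Notation off := (offset T).

Definition ncodes : nat := #|{: cell M}|.
Definition code (g : cell M) : nat := enum_rank g.

(* Variable 0 is a constant, forced to be true. *)
Definition var (J c : nat) : nat := (J * ncodes + c).+1.
Definition nvars (cells : nat) : nat := (cells * ncodes).+1.

Definition left_constraints : seq constraint :=
  flatten [seq [:: [:: (var J (code (blank M)), (-1)%R)]] | J <- iota 0 off].

Definition word_code (w' : seq bool) (i : nat) : nat :=
  code (Some (nth false w' i), if i == 0 then Some (tm_start M) else None).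

Definition word_constraints : seq constraint :=
  flatten [seq [:: [:: (var (off + i) (word_code w i), (-1)%R)]] | i <- iota 0 (size w)].

Definition free_constraints : seq constraint :=
  flatten [seq [:: [:: (var (off + size w + i) (code (blank M)), (-1)%R);
                       (var (off + size w + i) (code (Some false, None)), (-1)%R);
                       (var (off + size w + i) (code (Some true, None)), (-1)%R);
                       (0, (-1)%R)]] | i <- iota 0 q].

Definition pad_constraints : seq constraint :=
  flatten [seq [:: [:: (var (off + size w + i) (code (blank M)), 1%R);
                       (var (off + size w + i.+1) (code (blank M)), (-1)%R)]]
          | i <- iota 0 (q - 1)].

Definition step_constraints : seq constraint :=
  flatten [seq flatten [seq
    [:: [:: (var J (code g.1.1), 1%R); (var J.+1 (code g.1.2), 1%R);
            (var J.+2 (code g.2), 1%R);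
            (var (J + W) (code (local_rule g.1.1 g.1.2 g.2)), (-1)%R); (0, (-2)%R)]]
    | g <- enum {: cell M * cell M * cell M}] | J <- iota 0 (T * W)].

Definition accept_constraints : seq constraint :=
  flatten [seq flatten [seq [:: [:: (var (T * W + j) (code g), 1%R)]]
    | g <- [seq g <- enum {: cell M} | rejecting g]] | j <- iota 0 W].

Definition tableau_constraints : seq constraint :=
  [:: [:: (0, (-1)%R)]] ++ (left_constraints ++ (word_constraints ++ (free_constraints ++
    (pad_constraints ++ (step_constraints ++ accept_constraints))))).

Lemma code_lt g : code g < ncodes.
Proof. exact: ltn_ord. Qed.

Lemma var_lt J g cells : J < cells -> var J (code g) < nvars cells.
Proof.
move=> HJ; rewrite /var /nvars ltnS; have := code_lt g.
have : J.+1 * ncodes <= cells * ncodes by rewrite leq_mul2r HJ orbT.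
by rewrite mulSn; lia.
Qed.

Lemma var_decode J g : (var J (code g)).-1 %/ ncodes = J /\ (var J (code g)).-1 %% ncodes = code g.
Proof.
have := code_lt g => Hg; rewrite /var /= divnMDl ?modnMDl; last by lia.
by rewrite divn_small // modn_small // addn0.
Qed.

Lemma var_eq J g J' g' : (var J (code g) == var J' (code g')) = (J == J') && (g == g').
Proof.
apply/eqP/andP => [E|[/eqP -> /eqP ->]] //.
have [HJ Hg] := var_decode J g; have [HJ' Hg'] := var_decode J' g'.
rewrite E in HJ Hg; split; apply/eqP; first exact: etrans (esym HJ) HJ'.
exact/enum_rank_inj/val_inj/(etrans (esym Hg) Hg').
Qed.

Lemma all_flatten_one (A : Type) (p : pred constraint) (f : A -> constraint) (l : seq A) :
  all p (flatten [seq [:: f a] | a <- l]) = all (fun a => p (f a)) l.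
Proof. by elim: l => //= a l ->. Qed.

Lemma all_flatten_map (A : Type) (p : pred constraint) (f : A -> seq constraint) (l : seq A) :
  all p (flatten [seq f a | a <- l]) = all (fun a => all p (f a)) l.
Proof. by elim: l => //= a l <-; rewrite all_cat. Qed.

Lemma all_iota (p : pred nat) n : reflect (forall i, i < n -> p i) (all p (iota 0 n)).
Proof.
apply: (iffP allP) => H i; first by move=> Hi; apply: H; rewrite mem_iota.
by rewrite mem_iota => Hi; apply: H.
Qed.

Lemma tableau_constraintsP (s : nat -> bool) :
  all (holds (nvars (T.+1 * W)) s) tableau_constraints <->
  s 0 /\ satisfies w q T (fun J g => s (var J (code g))).
Proof.
have Hw := width_gt2 q T w_gt0.
have HW : W = off + (size w + q) by [].
have lt J g : J < T.+1 * W -> var J (code g) < nvars (T.+1 * W) by exact: var_lt.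
have lt0 : 0 < nvars (T.+1 * W) by [].
have row0 J : J < W -> J < T.+1 * W by rewrite mulSn; lia.
rewrite /tableau_constraints all_cat all_seq1 holds_true //.
case Hs0 : (s 0); last by split=> // -[].
rewrite !all_cat /= /left_constraints /word_constraints /free_constraints /pad_constraints
  /step_constraints /accept_constraints !all_flatten_one.
have uniq3 J : uniq [:: var J (code (blank M)); var J (code (Some false, None));
    var J (code (Some true, None)); 0].
  by rewrite /= !inE !var_eq !eqxx.
(* The variables of a step clause belong to four different cells, again because the width exceeds 2,
   and [var] is never 0, the index of the constant. *)
have uniq_step J g1 g2 g3 g4 :
    uniq [:: var J (code g1); var J.+1 (code g2); var J.+2 (code g3); var (J + W) (code g4); 0].
  have E1 : (J == J.+1) = false by lia.
  have E2 : (J == J.+2) = false by lia.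
  have E3 : (J == J + W) = false by lia.
  have E4 : (J.+1 == J.+2) = false by lia.
  have E5 : (J.+1 == J + W) = false by lia.
  have E6 : (J.+2 == J + W) = false by lia.
  by rewrite [uniq _]/= !inE !var_eq E1 E2 E3 E4 E5 E6.
have pad i : i < q - 1 ->
    holds (nvars (T.+1 * W)) s [:: (var (off + size w + i) (code (blank M)), 1%R);
                       (var (off + size w + i.+1) (code (blank M)), (-1)%R)]
    = (s (var (off + size w + i) (code (blank M))) ==>
       s (var (off + size w + i.+1) (code (blank M)))).
  move=> Hi; apply: holds_implies; [|by apply/lt/row0; lia..].
  by rewrite var_eq eqxx andbT; lia.
split.
- move=> /and5P[/all_iota H1 /all_iota H2 /all_iota H3 /all_iota H4 /andP[H5 H6]]; split=> //; split.
  + by move=> J HJ; have := H1 J HJ; rewrite holds_true // lt // row0; lia.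
  + move=> i Hi; have := H2 i Hi; rewrite holds_true; last by apply: lt; apply: row0; lia.
    exact.
  + move=> i Hi; have HJ : off + size w + i < T.+1 * W by apply: row0; lia.
    have := H3 i Hi; rewrite (holds_or3 (uniq3 _)) //.
    by rewrite /= !(lt _ _ HJ).
  + move=> i Hi; have Hi1 : i < q - 1 by lia.
    have := H4 i Hi1; rewrite pad // => /implyP; exact.
  + move=> J a b c HJ Ha Hb Hc.
    move: H5; rewrite all_flatten_map => /all_iota/(_ J HJ); rewrite all_flatten_one.
    move=> /allP/(_ (a, b, c)); rewrite mem_enum => /(_ isT) /=.
    rewrite (holds_horn3 (uniq_step _ _ _ _ _)) ?Ha ?Hb ?Hc //.
    by rewrite /= !lt //; rewrite mulSn; lia.
  + move=> j g Hj Hg; move: H6; rewrite all_flatten_map => /all_iota/(_ j Hj).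
    rewrite all_flatten_one => /allP/(_ g); rewrite mem_filter Hg mem_enum => /(_ isT).
    by rewrite holds_false // lt // mulSn; lia.
- move=> [_ [H1 H2 H3 H4 H5 H6]]; apply/and5P; split; try apply/all_iota.
  + by move=> J HJ; rewrite holds_true ?H1 // lt // row0; lia.
  + move=> i Hi; rewrite holds_true; last by apply: lt; apply: row0; lia.
    exact: H2.
  + move=> i Hi; have HJ : off + size w + i < T.+1 * W by apply: row0; lia.
    rewrite (holds_or3 (uniq3 _)) //; first exact: H3.
    by rewrite /= !(lt _ _ HJ).
  + by move=> i Hi; rewrite pad //; apply/implyP; apply: H4; lia.
  + apply/andP; split; rewrite all_flatten_map; apply/all_iota.
      move=> J HJ; rewrite all_flatten_one; apply/allP => -[[a b] c] _ /=.
      rewrite (holds_horn3 (uniq_step _ _ _ _ _)) //; last first.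
        by rewrite /= !lt // mulSn; lia.
      by apply/implyP => /and3P[Ha Hb Hc]; apply: H5.
    move=> j Hj; rewrite all_flatten_one; apply/allP => g; rewrite mem_filter => /andP[Hg _].
    by rewrite holds_false ?H6 // lt // mulSn; lia.
Qed.

Lemma tableau_constraints_accept :
  (exists s, all (holds (nvars (T.+1 * W)) s) tableau_constraints) <->
  exists2 u, size u <= q & tm_accept M (astate (arun M T (w ++ u))).
Proof.
split=> [[s /tableau_constraintsP[_ /(satisfies_accept w_gt0)]] //|[u Hu Hacc]].
have Hsat := satisfies_tableau w_gt0 Hu Hacc.
(* Division by [ncodes] splits a variable into its cell and the rank of a content; it is true if
   this content is the actual one. *)
exists (fun v => if v is v'.+1 then
  tableau M w q T (w ++ u) (v' %/ ncodes) == nth (blank M) (enum {: cell M}) (v' %% ncodes)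
  else true).
apply/tableau_constraintsP; split=> //.
suff <- : (fun J g => tableau M w q T (w ++ u) J == g) =
  (fun J g => tableau M w q T (w ++ u) ((var J (code g)).-1 %/ ncodes) ==
     nth (blank M) (enum {: cell M}) ((var J (code g)).-1 %% ncodes)) by [].
apply: functional_extensionality => J; apply: functional_extensionality => g.
by have [-> ->] := var_decode J g; rewrite nth_enum_rank.
Qed.

End Tableau_constraints.

(** * Computability of the tableau constraints *)

Section Family.
Variables (M : TM) (C : context).

Lemma FN_succ (n : C -> nat) : FN n -> FN (fun c => (n c).+1).
Proof. by move=> Hn; apply: FN_ext (FN_add (FN_const C 1) Hn). Qed.

Lemma FN_pbound a k (n : C -> nat) : FN n -> FN (fun c => pbound a k (n c)).
Proof.
by move=> Hn; apply: FN_add (FN_const C a); apply: FN_mul (FN_const C a) (FN_exp k Hn).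
Qed.

Lemma FN_var (J k : C -> nat) : FN J -> FN k -> FN (fun c => var M (J c) (k c)).
Proof.
by move=> HJ Hk; apply: FN_succ; apply: FN_add Hk; apply: FN_mul (FN_const C _).
Qed.

Lemma FN_offset (T : C -> nat) : FN T -> FN (fun c => offset (T c)).
Proof. by move=> HT; apply: FN_add (FN_mul (FN_const C 2) HT) (FN_const C 4). Qed.

Lemma FN_width (w : C -> seq bool) (q T : C -> nat) :
  FP w -> FN q -> FN T -> FN (fun c => width (w c) (q c) (T c)).
Proof.
by move=> Hw Hq HT; apply: FN_add (FN_offset HT) (FN_add (FN_size Hw) Hq).
Qed.

Lemma FN_word_code (w : C -> seq bool) (i : C -> nat) :
  FP w -> FN i -> FN (fun c => word_code M (w c) (i c)).
Proof.
move=> Hw Hi; have H0 := FB_eq Hi (FN_const C 0).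
pose k b i0 := code ((Some b, if i0 then Some (tm_start M) else None) : cell M).
have H b : FN (fun c => if i c == 0 then k b true else k b false).
  by apply: FN_if H0 _ _; exact: FN_const.
apply: FN_ext (FN_if (FB_nth Hw Hi) (H true) (H false)) => c.
by rewrite /word_code /k; case: nth; case: (i c == 0).
Qed.

End Family.

Lemma sparse_one (C : context) (k : C -> nat) (a : int) : FN k -> sparse (fun c => [:: (k c, a)]).
Proof. by move=> Hk; apply: sparse_cons => //; exact: sparse_nil. Qed.

Lemma family_tableau (M : TM) (C : context) (w : C -> seq bool) (q T N : C -> nat) :
    FP w -> FN q -> FN T -> FN N ->
  family N (fun c => tableau_constraints M (w c) (q c) (T c)).
Proof.
move=> Hw Hq HT HN; have HW := FN_width Hw Hq HT; have Ho := FN_offset HT.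
have Hs := FN_size Hw.
have HN' := FP_fst_nat HN; have HW' := FP_fst_nat HW; have Ho' := FP_fst_nat Ho.
have Hs' := FP_fst_nat Hs; have HT' := FP_fst_nat HT; have Hw' := FP_fst_nat Hw.
have Hi := FN_snd_nat C.
have Hk (D : context) g : FN (fun _ : D => @code M g) by exact: FN_const.
have HE : FN (C := with_nat C) (fun p => offset (T p.1) + size (w p.1) + p.2).
  exact: FN_add (FN_add Ho' Hs') Hi.
apply: family_cat; first by apply: (family_one HN); apply: sparse_one; exact: FN_const.
apply: family_cat.
  apply: (family_loop Ho); apply: (family_one HN'); apply: sparse_one.
  exact: FN_var.
apply: family_cat.
  apply: (family_loop Hs); apply: (family_one HN'); apply: sparse_one.
  by apply: FN_var (FN_word_code _ Hw' Hi); exact: FN_add Ho' Hi.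
apply: family_cat.
  apply: (family_loop Hq); apply: (family_one HN').
  by do 4 (apply: sparse_cons; first by [exact: FN_var | exact: FN_const]); exact: sparse_nil.
apply: family_cat.
  apply: (family_loop (FN_sub Hq (FN_const C 1))); apply: (family_one HN').
  apply: sparse_cons; first exact: FN_var.
  apply: sparse_one; apply: FN_var => //.
  exact: FN_add (FN_add Ho' Hs') (FN_succ Hi).
apply: family_cat.
  apply: (family_loop (FN_mul HT HW)); apply: family_const => g; apply: (family_one HN').
  apply: sparse_cons; first exact: FN_var.
  apply: sparse_cons; first exact: FN_var (FN_succ Hi) _.
  apply: sparse_cons; first exact: FN_var (FN_succ (FN_succ Hi)) _.
  apply: sparse_cons; first exact: FN_var (FN_add Hi HW') _.
  by apply: sparse_one; exact: FN_const.
apply: (family_loop HW); apply: family_const => g; apply: (family_one HN').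
apply: sparse_one; apply: FN_var => //.
exact: FN_add (FN_mul HT' HW') Hi.
Qed.

(** This lets a tableau of a single height serve certificates of all lengths, although each length
    has its own time bound. *)
Lemma arun_stable (M : TM) n m z :
  halts_within M n z -> n <= m -> arun M m z = arun M n z.
Proof.
rewrite /halts_within cstate_arun => Hh /subnK <-.
rewrite /arun iterD -/(arun M n z); case: (arun M n z) Hh => [[q h] t] Hh.
exact: iter_halted.
Qed.

Lemma leq_pbound c k m n : m <= n -> pbound c k m <= pbound c k n.
Proof. by move=> Hmn; rewrite /pbound leq_add2r leq_mul2l leq_expl // orbT. Qed.

Theorem theorem1 : NP_hard RELU_TRAIN.
Proof.
move=> L [V [c [k [Hhalt HL]]]].
pose q x := pbound c k (@size bool x).
(* The time bound for the longest admissible certificate, an upper bound for all the others by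
   monotonicity of [pbound]. *)
pose T x := pbound c k (size x + q x).
(* The verifier reads [sdelim x ++ u]: a known word, nonempty thanks to its terminator even if [x]
   is empty, followed directly by the certificate cells. *)
pose cs x := tableau_constraints V (sdelim x) (q x) (T x).
pose N x := nvars V ((T x).+1 * width (sdelim x) (q x) (T x)).
have Hx : FP (C := word_ctx) sdelim := FP_sdelim FP_word.
have Hn : FN (C := word_ctx) size := FN_size FP_word.
have Hq : FN (C := word_ctx) q by exact: FN_pbound.
have HT : FN (C := word_ctx) T by apply: FN_pbound; exact: FN_add.
have HN : FN (C := word_ctx) N.
  apply: FN_succ; apply: FN_mul (FN_const _ _).
  exact: FN_mul (FN_succ HT) (FN_width Hx Hq HT).
have Hf := FP_training_rows HN (family_tableau V Hx Hq HT HN).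
have [F [a [b HF]]] := FP_machine Hf.
exists F, a, b => x; have [Hhalts ->] := HF x; split=> //.
have w_gt0 : 0 < size (sdelim x) by rewrite /sdelim size_cat addnC.
have acc u : size u <= q x ->
  accepts_at V (pbound c k (size x + size u)) (pair_enc x u)
  = tm_accept V (astate (arun V (T x) (sdelim x ++ u))).
  move=> Hu; rewrite /accepts_at cstate_arun (arun_stable (Hhalt x u)) //.
  by apply: leq_pbound; rewrite leq_add2l.
rewrite RELU_TRAIN_rows // tableau_constraints_accept // HL.
split=> [[u [Hu Hacc]]|[u Hu Hacc]]; exists u; first exact: Hu.
  by rewrite -acc.
by rewrite acc.
Qed.
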